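(* $\mathsf{RCA}_0$ proves the following. Let $f\colon\mathbb{N}\to\mathbb{N}$ be an injection, let $P$ be a finite partial order, let $x\in P$, and let $Q=\Xi_f(P,x)$. If $Q$ is not a wqo, then the range of $f$ exists, i.e., there is a set $X$ such that $\forall n(n\in X\leftrightarrow\exists m(f(m)=n))$.
   Context: $\mathsf{RCA}_0$ is the usual base theory of second-order arithmetic: the axioms of a discretely ordered commutative semiring with identity for $\mathbb{N}$, $\Sigma^0_1$ induction, and $\Delta^0_1$ comprehension. All sets are subsets of $\mathbb{N}$, with the usual coding of pairs and finite sets as numbers. A quasi-order is a set $Q$ with a reflexive transitive relation $\leq_Q$ (a partial order if also antisymmetric). It is a well-quasi-order (wqo) if for every $g\colon\mathbb{N}\to Q$ there are $m<n$ with $g(m)\leq_Q g(n)$. Write $p<_Q q$ for $p\leq_Q q$ and $q\nleq_Q p$; $p,q$ are incomparable if $p\nleq_Q q$ and $q\nleq_Q p$. True stages: for an injection $f\colon\mathbb{N}\to\mathbb{N}$, $n$ is $f$-true at stage $s$ if $n<s$ and $\forall k(n<k\leq s\to f(n)<f(k))$. Let $T_s=\{n<s: n\text{ is }f\text{-true at stage }s\}$ (note $T_{s+1}\subseteq T_s\cup\{s\}$). Definition of $Q=\Xi_f(P,x)$ for $f$ an injection, $P$ a finite partial order, $x\in P$: let $P_n=\{n\}\times P$ (a copy of $P$, ordered by $\leq_{P_n}$) and $x_n=(n,x)$. The domain of $Q$ is $\bigcup_{n\in\mathbb{N}}P_n$. The partial order $\leq_Q$ is defined in stages, being defined on $\bigcup_{n\leq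 s}P_n$ at stage $s$. - Stage $0$: $\leq_Q$ is $\leq_{P_0}$ on $P_0$. - Stage $s+1$, with $\leq_Q$ already defined on $\bigcup_{n\leq s}P_n$: (i) If $T_{s+1}\subsetneqq T_s\cup\{s\}$, let $n_0$ be the least element of $(T_s\cup\{s\})\setminus T_{s+1}$ and place $P_{s+1}$ immediately above $x_{n_0}$: every element of $P_{s+1}$ is placed above all $y\in\bigcup_{n\leq s}P_n$ with $y\leq_Q x_{n_0}$, below all $y\in\bigcup_{n\leq s}P_n$ with $y>_Q x_{n_0}$, and incomparable with all $y\in\bigcup_{n\leq s}P_n$ incomparable with $x_{n_0}$. (ii) If $T_{s+1}=T_s\cup\{s\}$, place $P_{s+1}$ immediately below $x_s$: every element of $P_{s+1}$ is placed above all $y\in\bigcup_{n\leq s}P_n$ with $y<_Q x_s$, below all $y\in\bigcup_{n\leq s}P_n$ with $y\geq_Q x_s$, and incomparable with all $y\in\bigcup_{n\leq s}P_n$ incomparable with $x_s$. In both cases $\leq_Q$ restricted to $P_{s+1}$ is $\leq_{P_{s+1}}$. *)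

(* Defs.v *)
From Stdlib Require List.

(** The two-sorted language of second-order arithmetic, with de Bruijn indices: number
    variables and set variables are indexed independently of each other, [AllN]
    binding number variable 0 and [AllS] set variable 0.  A set term is just a set variable. *)
Inductive term : Set :=
| Var (n : nat)
| Zero
| One
| Plus (s t : term)
| Times (s t : term).

(** Equality is primitive for numbers only; there is no primitive equality
    between sets. *)
Inductive form : Set :=
| Bot
| Eq (s t : term)
| Lt (s t : term)
| Mem (t : term) (X : nat)
| Imp (A B : form)
| AllN (A : form)
| AllS (A : form).

Definition Neg (A : form) : form := Imp A Bot.
Definition And (A B : form) : form := Neg (Imp A (Neg B)).
Definition Or (A B : form) : form := Imp (Neg A) B.
Definition Iff (A B : form) : form := And (Imp A B) (Imp B A).
Definition ExN (A : form) : form := Neg (AllN (Neg A)).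
Definition ExS (A : form) : form := Neg (AllS (Neg A)).

Fixpoint tsubst (sg : nat -> term) (t : term) : term :=
  match t with
  | Var n => sg n
  | Zero => Zero
  | One => One
  | Plus s t => Plus (tsubst sg s) (tsubst sg t)
  | Times s t => Times (tsubst sg s) (tsubst sg t)
  end.

Definition tshift (t : term) : term := tsubst (fun n => Var (S n)) t.

Definition upN (sg : nat -> term) (n : nat) : term :=
  match n with 0 => Var 0 | S n => tshift (sg n) end.

Definition upS (rh : nat -> nat) (n : nat) : nat :=
  match n with 0 => 0 | S n => S (rh n) end.

Fixpoint subst (sg : nat -> term) (rh : nat -> nat) (A : form) : form :=
  match A with
  | Bot => Bot
  | Eq s t => Eq (tsubst sg s) (tsubst sg t)
  | Lt s t => Lt (tsubst sg s) (tsubst sg t)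
  | Mem t X => Mem (tsubst sg t) (rh X)
  | Imp A B => Imp (subst sg rh A) (subst sg rh B)
  | AllN A => AllN (subst (upN sg) rh A)
  | AllS A => AllS (subst sg (upS rh) A)
  end.

Definition shiftN (A : form) : form := subst (fun n => Var (S n)) (fun X => X) A.
Definition shiftS (A : form) : form := subst Var S A.

(** [instN A t] and [instS A Y] are the bodies of [AllN A] and [AllS A]
    instantiated at the term [t] and at the set variable [Y]. *)
Definition instN (A : form) (t : term) : form :=
  subst (fun n => match n with 0 => t | S n => Var n end) (fun X => X) A.
Definition instS (A : form) (Y : nat) : form :=
  subst Var (fun X => match X with 0 => Y | S X => X end) A.

(** [succN A] is A(x + 1), where x is number variable 0 of [A], still free. *)
Definition succN (A : form) : form :=
  subst (fun n => match n with 0 => Plus (Var 0) One | S n => Var (S n) end)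
        (fun X => X) A.

(** The axioms in [T] may have free variables (parameters) and then stand for
    their universal closures: the generalization rules shift the hypotheses in
    [G] but leave [T] alone. *)
Inductive prv (T : form -> Prop) : list form -> form -> Prop :=
| prv_ax G A : T A -> prv T G A
| prv_hyp G A : List.In A G -> prv T G A
| prv_impI G A B : prv T (cons A G) B -> prv T G (Imp A B)
| prv_impE G A B : prv T G (Imp A B) -> prv T G A -> prv T G B
| prv_dne G A : prv T G (Neg (Neg A)) -> prv T G A
| prv_allNI G A : prv T (List.map shiftN G) A -> prv T G (AllN A)
| prv_allNE G A t : prv T G (AllN A) -> prv T G (instN A t)
| prv_allSI G A : prv T (List.map shiftS G) A -> prv T G (AllS A)
| prv_allSE G A Y : prv T G (AllS A) -> prv T G (instS A Y)
| prv_refl G t : prv T G (Eq t t)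
| prv_leibniz G A s t : prv T G (Eq s t) -> prv T G (instN A s) -> prv T G (instN A t).

(** [tm], [sv] and [fm] are terms, set variables and formulas awaiting the number
    of enclosing number binders ([d]) and set binders ([e]).  A variable bound
    under [d] binders of its sort has, under [d'] of them, index [d' - S d]. *)
Definition tm : Set := nat -> term.
Definition sv : Set := nat -> nat.
Definition fm : Set := nat -> nat -> form.

Definition tzero : tm := fun _ => Zero.
Definition tone : tm := fun _ => One.
Definition tplus (a b : tm) : tm := fun d => Plus (a d) (b d).
Definition ttimes (a b : tm) : tm := fun d => Times (a d) (b d).

Definition feq (a b : tm) : fm := fun d _ => Eq (a d) (b d).
Definition flt (a b : tm) : fm := fun d _ => Lt (a d) (b d).
Definition fmem (a : tm) (X : sv) : fm := fun d e => Mem (a d) (X e).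
Definition fneg (p : fm) : fm := fun d e => Neg (p d e).
Definition fimp (p q : fm) : fm := fun d e => Imp (p d e) (q d e).
Definition fand (p q : fm) : fm := fun d e => And (p d e) (q d e).
Definition for_ (p q : fm) : fm := fun d e => Or (p d e) (q d e).
Definition fiff (p q : fm) : fm := fun d e => Iff (p d e) (q d e).
Definition fall (p : tm -> fm) : fm :=
  fun d e => AllN (p (fun d' => Var (d' - S d)) (S d) e).
Definition fex (p : tm -> fm) : fm :=
  fun d e => ExN (p (fun d' => Var (d' - S d)) (S d) e).
Definition fallS (p : sv -> fm) : fm :=
  fun d e => AllS (p (fun e' => e' - S e) d (S e)).
Definition fexS (p : sv -> fm) : fm :=
  fun d e => ExS (p (fun e' => e' - S e) d (S e)).

Definition sentence (p : fm) : form := p 0 0.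

Declare Scope tm_scope.
Delimit Scope tm_scope with tm.
Bind Scope tm_scope with tm.
Declare Scope fm_scope.
Delimit Scope fm_scope with fm.
Bind Scope fm_scope with fm.

Notation "0" := tzero : tm_scope.
Notation "1" := tone : tm_scope.
Notation "a + b" := (tplus a b) : tm_scope.
Notation "a * b" := (ttimes a b) : tm_scope.

Notation "a = b" := (feq a b) : fm_scope.
Notation "a < b" := (flt a b) : fm_scope.
Notation "a ∈ X" := (fmem a X) (at level 70) : fm_scope.
Notation "¬ p" := (fneg p) (at level 75, right associativity) : fm_scope.
Notation "p ∧ q" := (fand p q) (at level 80, right associativity) : fm_scope.
Notation "p ∨ q" := (for_ p q) (at level 85, right associativity) : fm_scope.
Notation "p → q" := (fimp p q)
  (at level 99, q at level 200, right associativity) : fm_scope.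
Notation "p ↔ q" := (fiff p q) (at level 95, no associativity) : fm_scope.
Notation "∀ x .. y , p" := (fall (fun x => .. (fall (fun y => p)) ..))
  (at level 200, x binder, y binder, right associativity) : fm_scope.
Notation "∃ x .. y , p" := (fex (fun x => .. (fex (fun y => p)) ..))
  (at level 200, x binder, y binder, right associativity) : fm_scope.
Notation "∀₂ X .. Y , p" := (fallS (fun X => .. (fallS (fun Y => p)) ..))
  (at level 200, X binder, Y binder, right associativity) : fm_scope.
Notation "∃₂ X .. Y , p" := (fexS (fun X => .. (fexS (fun Y => p)) ..))
  (at level 200, X binder, Y binder, right associativity) : fm_scope.

Local Open Scope fm_scope.

Definition fle (a b : tm) : fm := a < b ∨ a = b.
Notation "a <= b" := (fle a b) : fm_scope.

(** Bounded-quantifier formulas, with number and set parameters.  The bound [t]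
    is shifted, so the quantified variable does not occur in it. *)
Inductive delta0 : form -> Prop :=
| delta0_bot : delta0 Bot
| delta0_eq s t : delta0 (Eq s t)
| delta0_lt s t : delta0 (Lt s t)
| delta0_mem t X : delta0 (Mem t X)
| delta0_imp A B : delta0 A -> delta0 B -> delta0 (Imp A B)
| delta0_ball t A : delta0 A -> delta0 (AllN (Imp (Lt (Var 0) (tshift t)) A))
| delta0_bex t A : delta0 A -> delta0 (ExN (And (Lt (Var 0) (tshift t)) A)).

Inductive sigma01 : form -> Prop :=
| sigma01_intro A : delta0 A -> sigma01 (ExN A).

Inductive pi01 : form -> Prop :=
| pi01_intro A : delta0 A -> pi01 (AllN A).

(** Discretely ordered commutative semirings with identity, in the usual
    axiomatization PA^-, which includes subtraction ([ax_sub]). *)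
Inductive semiring_axiom : form -> Prop :=
| ax_addA : semiring_axiom (sentence (∀ a b c, (a + b) + c = a + (b + c)))
| ax_addC : semiring_axiom (sentence (∀ a b, a + b = b + a))
| ax_add0 : semiring_axiom (sentence (∀ a, a + 0 = a))
| ax_mulA : semiring_axiom (sentence (∀ a b c, (a * b) * c = a * (b * c)))
| ax_mulC : semiring_axiom (sentence (∀ a b, a * b = b * a))
| ax_mul1 : semiring_axiom (sentence (∀ a, a * 1 = a))
| ax_mul0 : semiring_axiom (sentence (∀ a, a * 0 = 0))
| ax_mulD : semiring_axiom (sentence (∀ a b c, a * (b + c) = a * b + a * c))
| ax_lt_irr : semiring_axiom (sentence (∀ a, ¬ a < a))
| ax_lt_trans : semiring_axiom (sentence (∀ a b c, a < b ∧ b < c → a < c))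
| ax_lt_total : semiring_axiom (sentence (∀ a b, a < b ∨ a = b ∨ b < a))
| ax_lt_add : semiring_axiom (sentence (∀ a b c, a < b → a + c < b + c))
| ax_lt_mul : semiring_axiom (sentence (∀ a b c, 0 < c ∧ a < b → a * c < b * c))
| ax_sub : semiring_axiom (sentence (∀ a b, a < b → ∃ c, a + c = b))
| ax_0_least : semiring_axiom (sentence (∀ a, 0 <= a))
| ax_0_lt_1 : semiring_axiom (sentence (0 < 1))
| ax_discrete : semiring_axiom (sentence (∀ a, 0 < a → 1 <= a)).

(** In both schemes number variable 0 of [A] (and [B]) is the variable n of the
    scheme and all other free variables are parameters; [shiftS] makes room for
    the set asserted to exist, so that it does not occur in [A]. *)
Inductive RCA0 : form -> Prop :=
| RCA0_semiring A : semiring_axiom A -> RCA0 A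
| RCA0_induction A : sigma01 A ->
    RCA0 (Imp (And (instN A Zero) (AllN (Imp A (succN A)))) (AllN A))
| RCA0_comprehension A B : sigma01 A -> pi01 B ->
    RCA0 (Imp (AllN (Iff A B)) (ExS (AllN (Iff (Mem (Var 0) 0) (shiftS A))))).

Definition RCA0_proves (p : fm) : Prop := prv RCA0 nil (sentence p).

(** The pairing function (a + b)^2 + a, injective over RCA_0. *)
Definition tpair (a b : tm) : tm := (a + b) * (a + b) + a.
Notation "⟨ a , b ⟩" := (tpair a b) : tm_scope.

Definition relation_on (A R : sv) : fm :=
  ∀ z, z ∈ R → ∃ a b, a ∈ A ∧ b ∈ A ∧ z = ⟨a, b⟩.

(** Functions are sets of pairs; f(n) = a is written ⟨n, a⟩ ∈ F. *)
Definition functional (F : sv) : fm :=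
  (∀ n, ∃ a, ⟨n, a⟩ ∈ F) ∧ (∀ n a b, ⟨n, a⟩ ∈ F ∧ ⟨n, b⟩ ∈ F → a = b).
Definition maps_N_to (F A : sv) : fm :=
  (∀ z, z ∈ F → ∃ n a, a ∈ A ∧ z = ⟨n, a⟩) ∧ functional F.
Definition maps_N_to_N (F : sv) : fm :=
  (∀ z, z ∈ F → ∃ n a, z = ⟨n, a⟩) ∧ functional F.
Definition injection (F : sv) : fm :=
  maps_N_to_N F ∧ ∀ m n a, ⟨m, a⟩ ∈ F ∧ ⟨n, a⟩ ∈ F → m = n.

(** In second-order arithmetic a set is finite when it is bounded; over RCA_0 this
    is the same as being coded by a number. *)
Definition finite_set (A : sv) : fm := ∃ b, ∀ a, a ∈ A → a < b.

Definition quasi_order (A R : sv) : fm :=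
  relation_on A R
  ∧ (∀ a, a ∈ A → ⟨a, a⟩ ∈ R)
  ∧ (∀ a b c, ⟨a, b⟩ ∈ R ∧ ⟨b, c⟩ ∈ R → ⟨a, c⟩ ∈ R).

Definition partial_order (A R : sv) : fm :=
  quasi_order A R ∧ ∀ a b, ⟨a, b⟩ ∈ R ∧ ⟨b, a⟩ ∈ R → a = b.

Definition wqo (A R : sv) : fm :=
  quasi_order A R
  ∧ ∀₂ G, maps_N_to G A →
      ∃ m n a b, m < n ∧ ⟨m, a⟩ ∈ G ∧ ⟨n, b⟩ ∈ G ∧ ⟨a, b⟩ ∈ R.

Definition strictly_below (R : sv) (a b : tm) : fm := ⟨a, b⟩ ∈ R ∧ ¬ ⟨b, a⟩ ∈ R.
Definition incomparable (R : sv) (a b : tm) : fm := ¬ ⟨a, b⟩ ∈ R ∧ ¬ ⟨b, a⟩ ∈ R.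

(** n is f-true at stage s, that is, n ∈ T_s. *)
Definition true_at (F : sv) (n s : tm) : fm :=
  n < s ∧ ∀ k, n < k ∧ k <= s → ∃ a b, ⟨n, a⟩ ∈ F ∧ ⟨k, b⟩ ∈ F ∧ a < b.

(** n ∈ T_s ∪ {s} *)
Definition candidate (F : sv) (n s : tm) : fm := true_at F n s ∨ n = s.

(** n ∈ (T_s ∪ {s}) \ T_{s+1} *)
Definition dropped (F : sv) (n s : tm) : fm :=
  candidate F n s ∧ ¬ true_at F n (s + 1).

(** T_{s+1} ⊊ T_s ∪ {s} *)
Definition stage_drops (F : sv) (s : tm) : fm :=
  (∀ n, true_at F n (s + 1) → candidate F n s) ∧ (∃ n, dropped F n s).

(** T_{s+1} = T_s ∪ {s} *)
Definition stage_keeps (F : sv) (s : tm) : fm :=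
  ∀ n, true_at F n (s + 1) ↔ candidate F n s.

Definition least_dropped (F : sv) (n s : tm) : fm :=
  dropped F n s ∧ ∀ k, dropped F k s → n <= k.

(** [placed_above R z w y]: relative to the earlier element y, the new element z
    sits immediately above w; likewise [placed_below].  "Above" and "below" are
    strict, as z and y lie in different copies of P. *)
Definition placed_above (R : sv) (z w y : tm) : fm :=
  (⟨y, w⟩ ∈ R → strictly_below R y z)
  ∧ (strictly_below R w y → strictly_below R z y)
  ∧ (incomparable R y w → incomparable R z y).
Definition placed_below (R : sv) (z w y : tm) : fm :=
  (strictly_below R y w → strictly_below R y z)
  ∧ (⟨w, y⟩ ∈ R → strictly_below R z y)
  ∧ (incomparable R y w → incomparable R z y).

(** (Q, leQ) is Ξ_f(P, x), for P ordered by leP and f with graph F.  The order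
    between elements of the first s + 1 copies of P is settled by stage s and
    never revised, so the stagewise definition is a recursion on leQ itself: the
    first three clauses fix its field and its restriction to each copy of P, the
    last two compare the copy numbered s + 1 with the earlier ones. *)
Definition is_Xi (F P leP : sv) (x : tm) (Q leQ : sv) : fm :=
  (∀ z, z ∈ Q ↔ ∃ n p, p ∈ P ∧ z = ⟨n, p⟩)
  ∧ relation_on Q leQ
  ∧ (∀ n p q, p ∈ P ∧ q ∈ P → (⟨⟨n, p⟩, ⟨n, q⟩⟩ ∈ leQ ↔ ⟨p, q⟩ ∈ leP))
  ∧ (∀ s, stage_drops F s →
       ∀ n0, least_dropped F n0 s →
       ∀ p n q, p ∈ P ∧ n <= s ∧ q ∈ P →
         placed_above leQ ⟨s + 1, p⟩ ⟨n0, x⟩ ⟨n, q⟩)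
  ∧ (∀ s, stage_keeps F s →
       ∀ p n q, p ∈ P ∧ n <= s ∧ q ∈ P →
         placed_below leQ ⟨s + 1, p⟩ ⟨s, x⟩ ⟨n, q⟩).

(* Main.v *)
From Stdlib Require Import Arith Lia List Cantor Classical ClassicalEpsilon Ring.
From Stdlib Require Import FunctionalExtensionality PropExtensionality ProofIrrelevance.
Require Import Defs.
Import ListNotations.

(** Write T_m for the set of numbers that are f-true at stage m.  If t < m, then the
    whole copy P_m lies strictly below x_t when t ∈ T_m and strictly above x_t when not
    ([later_copies]): true candidates carry a descending chain of x's, every new copy is
    placed at the lower end of the surviving part of that chain, and a stage that has been
    dropped stays below everything placed afterwards.  Hence if t ∈ T_n but t is dropped
    by stage m > n, then P_n < x_t < P_m, and the same holds for all stages after m.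

    Let G be a bad sequence, with terms G(i) in the copies n_i.  It is one-to-one and P is
    finite, so it reaches arbitrarily late copies.  By the above no t ∈ T_(n_i) is ever
    dropped: otherwise some later term of G would be above G(i) ([bad_true]).  For such a
    t all values of f below f(t) are taken at arguments up to t.  There are permanently
    true t with f(t) as large as desired, and each belongs to T_(n_i) once n_i > t
    ([bad_reaches]).  So v is outside the range of f exactly if some i and t ∈ T_(n_i)
    with v < f(t) satisfy f(k) <> v for all k <= t ([not_in_range_iff]), a Sigma^0_1
    condition, and Delta^0_1 comprehension yields the range.

    Failing to be a wqo could also mean failing to be a quasi-order, so transitivity
    of the order on Q has to be proved, by Pi^0_1 induction on the stages
    ([leQ_transitive_before]).

    Two facts about one-to-one functions, that f and G leave every bounded set for good
    ([one_to_one_unbounded]), need more than collection: which numbers below c are values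
    is only a Sigma^0_1 question.  [strong_bounding] answers it by coding Sigma^0_1 subsets
    of [0, c) as divisors of a number, the least number with the required divisors being
    exact.

    All this reasoning takes place in an arbitrary model; provability follows from a
    Henkin-style completeness theorem for the two-sorted calculus ([completeness]).  In a
    model the two schemes are available for predicates that are definable with
    parameters, and the classes [D0], [Sig] and [Pi] of such predicates are handled
    through their closure properties. *)

(** * Substitution *)

Lemma tsubst_ext sg sg' t : (forall n, sg n = sg' n) -> tsubst sg t = tsubst sg' t.
Proof. intros H; f_equal; now apply functional_extensionality. Qed.

Lemma tsubst_tsubst sg sg' t :
  tsubst sg (tsubst sg' t) = tsubst (fun n => tsubst sg (sg' n)) t.
Proof. induction t; cbn; congruence. Qed.

Lemma tsubst_Var t : tsubst Var t = t.
Proof. induction t; cbn; congruence. Qed.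

Lemma tsubst_upN_tshift sg t : tsubst (upN sg) (tshift t) = tshift (tsubst sg t).
Proof. unfold tshift; now rewrite !tsubst_tsubst. Qed.

Lemma upN_comp sg sg' :
  (fun n => tsubst (upN sg) (upN sg' n)) = upN (fun n => tsubst sg (sg' n)).
Proof.
  apply functional_extensionality; intros [|n]; cbn; [easy | apply tsubst_upN_tshift].
Qed.

Lemma upS_comp rh rh' : (fun X => upS rh (upS rh' X)) = upS (fun X => rh (rh' X)).
Proof. now apply functional_extensionality; intros [|n]. Qed.

Lemma upN_Var : upN Var = Var.
Proof. now apply functional_extensionality; intros [|n]. Qed.

Lemma upS_id : upS (fun X => X) = fun X => X.
Proof. now apply functional_extensionality; intros [|n]. Qed.

Lemma subst_subst A : forall sg rh sg' rh',
  subst sg rh (subst sg' rh' A)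
  = subst (fun n => tsubst sg (sg' n)) (fun X => rh (rh' X)) A.
Proof.
  induction A; intros; cbn; rewrite ?tsubst_tsubst, ?IHA1, ?IHA2, ?IHA, ?upN_comp;
    try easy.
  now rewrite upS_comp.
Qed.

Lemma subst_Var A : subst Var (fun X => X) A = A.
Proof.
  induction A; cbn; rewrite ?tsubst_Var, ?upN_Var, ?upS_id; congruence.
Qed.

Lemma subst_eq sg rh sg' rh' A :
  (forall n, sg n = sg' n) -> (forall X, rh X = rh' X) ->
  subst sg rh A = subst sg' rh' A.
Proof. intros H H'; f_equal; now apply functional_extensionality. Qed.

Lemma subst_instN sg rh A t :
  subst sg rh (instN A t) = instN (subst (upN sg) rh A) (tsubst sg t).
Proof.
  unfold instN; rewrite !subst_subst; apply subst_eq; [|easy].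
  intros [|n]; cbn; [easy|]. unfold tshift; rewrite tsubst_tsubst.
  symmetry; apply tsubst_Var.
Qed.

Lemma subst_instS sg rh A Y :
  subst sg rh (instS A Y) = instS (subst sg (upS rh) A) (rh Y).
Proof.
  unfold instS; rewrite !subst_subst; apply subst_eq.
  - intros n; symmetry; apply tsubst_Var.
  - now intros [|X].
Qed.

Lemma subst_shiftN sg rh A : subst (upN sg) rh (shiftN A) = shiftN (subst sg rh A).
Proof. unfold shiftN; rewrite !subst_subst; now apply subst_eq. Qed.

Lemma subst_shiftS sg rh A : subst sg (upS rh) (shiftS A) = shiftS (subst sg rh A).
Proof.
  unfold shiftS; rewrite !subst_subst; apply subst_eq; [|easy].
  intros n; symmetry; apply tsubst_Var.
Qed.

Lemma subst_succN sg rh A : subst (upN sg) rh (succN A) = succN (subst (upN sg) rh A).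
Proof.
  unfold succN; rewrite !subst_subst; apply subst_eq; [|easy].
  intros [|n]; cbn; [easy|]. unfold tshift; rewrite tsubst_tsubst.
  now apply tsubst_ext.
Qed.

Lemma map_subst_shiftN sg rh G :
  map (subst (upN sg) rh) (map shiftN G) = map shiftN (map (subst sg rh) G).
Proof. rewrite !map_map; apply map_ext; intros; apply subst_shiftN. Qed.

Lemma map_subst_shiftS sg rh G :
  map (subst sg (upS rh)) (map shiftS G) = map shiftS (map (subst sg rh) G).
Proof. rewrite !map_map; apply map_ext; intros; apply subst_shiftS. Qed.

(** Together with [fmaxN] and [fmaxS]: strict upper bounds for the free variables.  Passing
    a binder leaves the bound unchanged, which over-approximates and keeps the recursion
    simple. *)
Fixpoint tmax (t : term) : nat :=
  match t with
  | Var n => S n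
  | Zero | One => 0
  | Plus s t | Times s t => max (tmax s) (tmax t)
  end.

Fixpoint fmaxN (A : form) : nat :=
  match A with
  | Bot => 0
  | Eq s t | Lt s t => max (tmax s) (tmax t)
  | Mem t X => tmax t
  | Imp A B => max (fmaxN A) (fmaxN B)
  | AllN A | AllS A => fmaxN A
  end.

Fixpoint fmaxS (A : form) : nat :=
  match A with
  | Bot | Eq _ _ | Lt _ _ => 0
  | Mem t X => S X
  | Imp A B => max (fmaxS A) (fmaxS B)
  | AllN A | AllS A => fmaxS A
  end.

Lemma tsubst_agree sg sg' t :
  (forall n, n < tmax t -> sg n = sg' n) -> tsubst sg t = tsubst sg' t.
Proof.
  induction t; cbn; intros H; auto; f_equal;
    try apply IHt1; try apply IHt2; intros; apply H; lia.
Qed.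

Lemma subst_agree A : forall sg rh sg' rh',
  (forall n, n < fmaxN A -> sg n = sg' n) ->
  (forall X, X < fmaxS A -> rh X = rh' X) ->
  subst sg rh A = subst sg' rh' A.
Proof.
  induction A; cbn; intros sg rh sg' rh' H H'; auto; f_equal;
    try (apply tsubst_agree; intros; apply H; lia);
    try (apply H'; lia);
    try (apply IHA1; intros; (apply H || apply H'); lia);
    try (apply IHA2; intros; (apply H || apply H'); lia);
    apply IHA; auto.
  - intros [|n] Hn; cbn; [easy | rewrite H; [easy | lia]].
  - intros [|n] Hn; cbn; [easy | rewrite H'; [easy | lia]].
Qed.

(** * Derivations *)

Definition subst_closed (T : form -> Prop) : Prop :=
  forall sg rh A, T A -> T (subst sg rh A).

Section Derivations.
Variable T : form -> Prop.
Hypothesis T_closed : subst_closed T.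

Lemma prv_weaken G A : prv T G A -> forall G', incl G G' -> prv T G' A.
Proof.
  induction 1; intros G' HG.
  - now apply prv_ax.
  - apply prv_hyp; auto.
  - apply prv_impI, IHprv, incl_cons; [now left | now apply incl_tl].
  - eapply prv_impE; eauto.
  - apply prv_dne; auto.
  - apply prv_allNI, IHprv, incl_map, HG.
  - apply prv_allNE; auto.
  - apply prv_allSI, IHprv, incl_map, HG.
  - apply prv_allSE; auto.
  - apply prv_refl.
  - eapply prv_leibniz; eauto.
Qed.

Lemma prv_subst G A : prv T G A ->
  forall sg rh, prv T (map (subst sg rh) G) (subst sg rh A).
Proof.
  induction 1; intros sg rh.
  - now apply prv_ax, T_closed.
  - now apply prv_hyp, in_map.
  - apply prv_impI, (IHprv sg rh).
  - eapply prv_impE; [apply (IHprv1 sg rh) | apply IHprv2].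
  - apply prv_dne, (IHprv sg rh).
  - apply prv_allNI. rewrite <- map_subst_shiftN. apply IHprv.
  - rewrite subst_instN. apply prv_allNE, (IHprv sg rh).
  - apply prv_allSI. rewrite <- map_subst_shiftS. apply IHprv.
  - rewrite subst_instS. apply prv_allSE, (IHprv sg rh).
  - apply prv_refl.
  - specialize (IHprv2 sg rh). rewrite subst_instN in *.
    eapply prv_leibniz; [apply (IHprv1 sg rh) | exact IHprv2].
Qed.

Definition maxN (G : list form) : nat := list_max (map fmaxN G).
Definition maxS (G : list form) : nat := list_max (map fmaxS G).

Lemma maxN_In G A : In A G -> fmaxN A <= maxN G.
Proof.
  intros H. pose proof (proj1 (list_max_le (map fmaxN G) (maxN G)) (le_n _)) as HF.
  rewrite Forall_forall in HF. now apply HF, in_map.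
Qed.

Lemma maxS_In G A : In A G -> fmaxS A <= maxS G.
Proof.
  intros H. pose proof (proj1 (list_max_le (map fmaxS G) (maxS G)) (le_n _)) as HF.
  rewrite Forall_forall in HF. now apply HF, in_map.
Qed.

(** The rule for [AllN] shifts the hypotheses instead of asking for a fresh variable.  The
    two are related by the substitution that sends the fresh variable to 0 and every other
    variable to its successor: it acts on the hypotheses as the shift. *)
Lemma prv_fresh_allN G A k :
  maxN G <= k -> fmaxN A <= k -> prv T G (instN A (Var k)) -> prv T G (AllN A).
Proof.
  intros HG HA H. apply prv_allNI.
  set (sg := fun n => if n =? k then Var 0 else Var (S n)).
  assert (Hsg : forall n, n < k -> sg n = Var (S n)).
  { intros n Hn; unfold sg. now rewrite (proj2 (Nat.eqb_neq n k)) by lia. }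
  apply (fun H => prv_subst _ _ H sg (fun X => X)) in H.
  replace (map shiftN G) with (map (subst sg (fun X => X)) G).
  - replace A with (subst sg (fun X => X) (instN A (Var k))); [exact H|].
    rewrite <- (subst_Var A) at 2. unfold instN; rewrite subst_subst.
    apply subst_agree; [|easy].
    intros [|n] Hn; cbn.
    + unfold sg. now rewrite Nat.eqb_refl.
    + apply Hsg; lia.
  - apply map_ext_in; intros B HB. apply subst_agree; [|easy].
    intros n Hn. apply Hsg. pose proof (maxN_In _ _ HB); lia.
Qed.

Lemma prv_fresh_allS G A k :
  maxS G <= k -> fmaxS A <= k -> prv T G (instS A k) -> prv T G (AllS A).
Proof.
  intros HG HA H. apply prv_allSI.
  set (rh := fun X => if X =? k then 0 else S X).
  assert (Hrh : forall X, X < k -> rh X = S X).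
  { intros X HX; unfold rh. now rewrite (proj2 (Nat.eqb_neq X k)) by lia. }
  apply (fun H => prv_subst _ _ H Var rh) in H.
  replace (map shiftS G) with (map (subst Var rh) G).
  - replace A with (subst Var rh (instS A k)); [exact H|].
    rewrite <- (subst_Var A) at 2. unfold instS; rewrite subst_subst.
    apply subst_agree; [easy|].
    intros [|n] Hn; cbn.
    + unfold rh. now rewrite Nat.eqb_refl.
    + apply Hrh; lia.
  - apply map_ext_in; intros B HB. apply subst_agree; [easy|].
    intros n Hn. apply Hrh. pose proof (maxS_In _ _ HB); lia.
Qed.

(** * A maximal consistent theory with witnesses *)

Fixpoint tcode (t : term) : nat :=
  match t with
  | Var n => to_nat (0, n)
  | Zero => to_nat (1, 0)
  | One => to_nat (2, 0)
  | Plus s t => to_nat (3, to_nat (tcode s, tcode t))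
  | Times s t => to_nat (4, to_nat (tcode s, tcode t))
  end.

Fixpoint fcode (A : form) : nat :=
  match A with
  | Bot => to_nat (0, 0)
  | Eq s t => to_nat (1, to_nat (tcode s, tcode t))
  | Lt s t => to_nat (2, to_nat (tcode s, tcode t))
  | Mem t X => to_nat (3, to_nat (tcode t, X))
  | Imp A B => to_nat (4, to_nat (fcode A, fcode B))
  | AllN A => to_nat (5, fcode A)
  | AllS A => to_nat (6, fcode A)
  end.

Ltac code_inj :=
  repeat match goal with
  | H : to_nat _ = to_nat _ |- _ => apply to_nat_inj in H
  | H : (_, _) = (_, _) |- _ => apply pair_equal_spec in H as []
  end.

Lemma tcode_inj s : forall t, tcode s = tcode t -> s = t.
Proof.
  induction s; intros []; cbn [tcode]; intros H; code_inj; try discriminate; f_equal; auto.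
Qed.

Lemma fcode_inj A : forall B, fcode A = fcode B -> A = B.
Proof.
  induction A; intros []; cbn [fcode]; intros H; code_inj; try discriminate;
    f_equal; auto using tcode_inj.
Qed.

Definition nth_form (n : nat) : form := epsilon (inhabits Bot) (fun A => fcode A = n).

Lemma nth_form_surj A : exists n, nth_form n = A.
Proof.
  exists (fcode A). apply fcode_inj. unfold nth_form.
  apply (epsilon_spec (inhabits Bot) (fun B => fcode B = fcode A)). now exists A.
Qed.

Definition consistent (G : list form) : Prop := ~ prv T G Bot.

(** A rejected universal formula gets a counterexample: a variable that is fresh
    for everything decided so far. *)
Definition decide (G : list form) (A : form) : list form :=
  if excluded_middle_informative (consistent (A :: G)) then A :: G
  else match A with
  | AllN B => Neg (instN B (Var (max (maxN G) (fmaxN B)))) :: G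
  | AllS B => Neg (instS B (max (maxS G) (fmaxS B))) :: G
  | _ => G
  end.

Lemma prv_dne_bot G A : prv T (Neg A :: G) Bot -> prv T G A.
Proof. intros H. now apply prv_dne, prv_impI. Qed.

Lemma decide_consistent G A : consistent G -> consistent (decide G A).
Proof.
  intros HG. unfold decide.
  destruct excluded_middle_informative as [HA|HA]; [exact HA|].
  apply NNPP in HA. apply prv_impI in HA.
  destruct A as [| | | | |B|B]; try exact HG; intros H; apply prv_dne_bot in H;
    apply HG; eapply prv_impE; [exact HA| |exact HA|].
  - eapply prv_fresh_allN; [| |exact H]; lia.
  - eapply prv_fresh_allS; [| |exact H]; lia.
Qed.

Lemma decide_incl G A : incl G (decide G A).
Proof.
  unfold decide. destruct excluded_middle_informative; [now apply incl_tl|].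
  destruct A; first [apply incl_refl | apply incl_tl, incl_refl].
Qed.

Section Completion.
Variable G0 : list form.
Hypothesis G0_consistent : consistent G0.

Fixpoint stage (n : nat) : list form :=
  match n with 0 => G0 | S n => decide (stage n) (nth_form n) end.

Definition completion (A : form) : Prop := exists n, prv T (stage n) A.

Lemma stage_consistent n : consistent (stage n).
Proof. induction n; [exact G0_consistent | now apply decide_consistent]. Qed.

Lemma stage_incl m n : m <= n -> incl (stage m) (stage n).
Proof.
  induction 1; [apply incl_refl|].
  eapply incl_tran; [eassumption | apply decide_incl].
Qed.

Lemma completion_ax A : T A -> completion A.
Proof. intros; exists 0; now apply prv_ax. Qed.

Lemma completion_mp A B : completion (Imp A B) -> completion A -> completion B.
Proof.
  intros [m Hm] [n Hn]. exists (max m n).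
  eapply prv_impE; eapply prv_weaken; try eassumption; apply stage_incl; lia.
Qed.

Lemma completion_bot : ~ completion Bot.
Proof. intros [n H]. exact (stage_consistent n H). Qed.

Lemma completion_neg A : completion (Neg A) <-> ~ completion A.
Proof.
  split.
  - intros H H'. exact (completion_bot (completion_mp _ _ H H')).
  - intros H. destruct (nth_form_surj A) as [n E].
    exists n. apply prv_impI. apply NNPP; intros HA. apply H.
    exists (S n). cbn. rewrite E. unfold decide.
    destruct excluded_middle_informative; [apply prv_hyp; now left | easy].
Qed.

Lemma completion_imp A B : completion (Imp A B) <-> (completion A -> completion B).
Proof.
  split; [apply completion_mp|]. intros H.
  destruct (classic (completion A)) as [HA|HA].
  - destruct (H HA) as [n Hn]. exists n. apply prv_impI.
    eapply prv_weaken; [exact Hn | now apply incl_tl].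
  - apply completion_neg in HA. destruct HA as [n Hn]. exists n. apply prv_impI, prv_dne.
    apply prv_impI. eapply prv_impE; [|apply prv_hyp; right; now left].
    eapply prv_weaken; [exact Hn | now apply incl_tl, incl_tl].
Qed.

Lemma completion_allN A :
  completion (AllN A) <-> forall t, completion (instN A t).
Proof.
  split; [intros [n Hn] t; exists n; now apply prv_allNE|].
  intros H. apply NNPP; intros HA.
  destruct (nth_form_surj (AllN A)) as [n E].
  assert (HS : ~ consistent (AllN A :: stage n)).
  { intros HC. apply HA. exists (S n). cbn. rewrite E. unfold decide.
    destruct excluded_middle_informative; [apply prv_hyp; now left | easy]. }
  eapply completion_neg; [|apply H]. exists (S n). cbn. rewrite E. unfold decide.
  destruct excluded_middle_informative; [easy | apply prv_hyp; now left].
Qed.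

Lemma completion_allS A :
  completion (AllS A) <-> forall Y, completion (instS A Y).
Proof.
  split; [intros [n Hn] t; exists n; now apply prv_allSE|].
  intros H. apply NNPP; intros HA.
  destruct (nth_form_surj (AllS A)) as [n E].
  assert (HS : ~ consistent (AllS A :: stage n)).
  { intros HC. apply HA. exists (S n). cbn. rewrite E. unfold decide.
    destruct excluded_middle_informative; [apply prv_hyp; now left | easy]. }
  eapply completion_neg; [|apply H]. exists (S n). cbn. rewrite E. unfold decide.
  destruct excluded_middle_informative; [easy | apply prv_hyp; now left].
Qed.

Lemma completion_refl t : completion (Eq t t).
Proof. exists 0. apply prv_refl. Qed.

Lemma completion_leibniz A s t :
  completion (Eq s t) -> completion (instN A s) -> completion (instN A t).
Proof.
  intros [m Hm] [n Hn]. exists (max m n).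
  eapply prv_leibniz; eapply prv_weaken; try eassumption; apply stage_incl; lia.
Qed.

End Completion.
End Derivations.

(** * Structures and completeness *)

(** The second sort is an arbitrary type with a membership relation, matching a language in
    which only numbers are compared for equality. *)
Record structure := {
  num : Type;
  set : Type;
  zero : num;
  one : num;
  add : num -> num -> num;
  mul : num -> num -> num;
  lt : num -> num -> Prop;
  mem : num -> set -> Prop
}.

Definition scons {D : Type} (x : D) (rho : nat -> D) (n : nat) : D :=
  match n with 0 => x | S n => rho n end.

Section Satisfaction.
Variable M : structure.

Fixpoint eval (rho : nat -> num M) (t : term) : num M :=
  match t with
  | Var n => rho n
  | Zero => zero M
  | One => one M
  | Plus s t => add M (eval rho s) (eval rho t)
  | Times s t => mul M (eval rho s) (eval rho t)
  end.

Fixpoint sat (rho : nat -> num M) (eta : nat -> set M) (A : form) : Prop :=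
  match A with
  | Bot => False
  | Eq s t => eval rho s = eval rho t
  | Lt s t => lt M (eval rho s) (eval rho t)
  | Mem t X => mem M (eval rho t) (eta X)
  | Imp A B => sat rho eta A -> sat rho eta B
  | AllN A => forall x, sat (scons x rho) eta A
  | AllS A => forall X, sat rho (scons X eta) A
  end.

Definition models (T : form -> Prop) : Prop :=
  forall A rho eta, T A -> sat rho eta A.

Lemma eval_tsubst rho sg t :
  eval rho (tsubst sg t) = eval (fun n => eval rho (sg n)) t.
Proof. induction t; cbn; congruence. Qed.

Lemma scons_upN rho sg x :
  (fun n => eval (scons x rho) (upN sg n)) = scons x (fun n => eval rho (sg n)).
Proof.
  apply functional_extensionality; intros [|n]; cbn; [easy|]. apply eval_tsubst.
Qed.

Lemma scons_upS {D : Type} (eta : nat -> D) rh X :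
  (fun n => scons X eta (upS rh n)) = scons X (fun n => eta (rh n)).
Proof. now apply functional_extensionality; intros [|n]. Qed.

Lemma sat_subst A : forall rho eta sg rh,
  sat rho eta (subst sg rh A)
  <-> sat (fun n => eval rho (sg n)) (fun X => eta (rh X)) A.
Proof.
  induction A; intros; cbn; rewrite ?eval_tsubst; try easy.
  - now rewrite IHA1, IHA2.
  - split; intros H x; specialize (H x); rewrite IHA, scons_upN in *; exact H.
  - split; intros H X; specialize (H X); rewrite IHA, scons_upS in *; exact H.
Qed.

(** The defined connectives have their classical meaning; stated as congruences, so
    that a formula and its meaning can be compared node by node. *)
Lemma sat_And rho eta A B P Q :
  (sat rho eta A <-> P) -> (sat rho eta B <-> Q) -> (sat rho eta (And A B) <-> P /\ Q).
Proof. cbn; tauto. Qed.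

Lemma sat_Or rho eta A B P Q :
  (sat rho eta A <-> P) -> (sat rho eta B <-> Q) -> (sat rho eta (Or A B) <-> P \/ Q).
Proof. cbn; tauto. Qed.

Lemma sat_Imp rho eta A B (P Q : Prop) :
  (sat rho eta A <-> P) -> (sat rho eta B <-> Q) -> (sat rho eta (Imp A B) <-> (P -> Q)).
Proof. cbn; tauto. Qed.

Lemma sat_Neg rho eta A (P : Prop) :
  (sat rho eta A <-> P) -> (sat rho eta (Neg A) <-> ~ P).
Proof. cbn; tauto. Qed.

Lemma sat_Iff rho eta A B P Q :
  (sat rho eta A <-> P) -> (sat rho eta B <-> Q) -> (sat rho eta (Iff A B) <-> (P <-> Q)).
Proof. cbn; tauto. Qed.

Lemma sat_AllN rho eta A (P : num M -> Prop) :
  (forall x, sat (scons x rho) eta A <-> P x) ->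
  (sat rho eta (AllN A) <-> forall x, P x).
Proof. cbn; firstorder. Qed.

Lemma sat_ExN rho eta A (P : num M -> Prop) :
  (forall x, sat (scons x rho) eta A <-> P x) ->
  (sat rho eta (ExN A) <-> exists x, P x).
Proof.
  cbn; intros H; split.
  - intros H'; apply NNPP; intros N; apply H'; intros x Hx; apply N; exists x; now apply H.
  - intros [x Hx] N; apply (N x); now apply H.
Qed.

Lemma sat_AllS rho eta A (P : set M -> Prop) :
  (forall X, sat rho (scons X eta) A <-> P X) ->
  (sat rho eta (AllS A) <-> forall X, P X).
Proof. cbn; firstorder. Qed.

Lemma sat_ExS rho eta A (P : set M -> Prop) :
  (forall X, sat rho (scons X eta) A <-> P X) ->
  (sat rho eta (ExS A) <-> exists X, P X).
Proof.
  cbn; intros H; split.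
  - intros H'; apply NNPP; intros N; apply H'; intros X HX; apply N; exists X; now apply H.
  - intros [X HX] N; apply (N X); now apply H.
Qed.

End Satisfaction.

(** Proves that a formula holds iff its meaning does, descending through both at once. *)
Ltac sat_congr :=
  lazymatch goal with
  | |- sat _ _ _ (And _ _) <-> _ => apply sat_And; sat_congr
  | |- sat _ _ _ (Or _ _) <-> _ => apply sat_Or; sat_congr
  | |- sat _ _ _ (Iff _ _) <-> _ => apply sat_Iff; sat_congr
  | |- sat _ _ _ (ExN _) <-> _ => apply sat_ExN; intro; sat_congr
  | |- sat _ _ _ (ExS _) <-> _ => apply sat_ExS; intro; sat_congr
  | |- sat _ _ _ (Neg _) <-> _ => apply sat_Neg; sat_congr
  | |- sat _ _ _ (Imp _ _) <-> _ => apply sat_Imp; sat_congr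
  | |- sat _ _ _ (AllN _) <-> _ => apply sat_AllN; intro; sat_congr
  | |- sat _ _ _ (AllS _) <-> _ => apply sat_AllS; intro; sat_congr
  | |- _ => exact (iff_refl _)
  end.

Section TermModel.
Variable T : form -> Prop.
Hypothesis T_closed : subst_closed T.
Variable G0 : list form.
Hypothesis G0_consistent : consistent T G0.

Notation Th := (completion T G0).

Lemma Th_rewrite A s t : Th (Eq s t) -> (Th (instN A s) <-> Th (instN A t)).
Proof.
  intros H; split; [now apply completion_leibniz|].
  apply completion_leibniz.
  pose proof (completion_leibniz T G0 (Eq (Var 0) (tshift s)) s t H) as E.
  unfold instN, tshift in E; cbn in E. rewrite !tsubst_tsubst in E; cbn in E.
  rewrite !tsubst_Var in E. apply E, completion_refl.
Qed.

Lemma instN_shift_l s t : tsubst (fun n => match n with 0 => t | S n => Var n end) (tshift s) = s.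
Proof. unfold tshift; rewrite tsubst_tsubst; apply tsubst_Var. Qed.

Definition equiv (s t : term) : Prop := Th (Eq s t).

Lemma equiv_refl t : equiv t t.
Proof. apply completion_refl. Qed.

Lemma equiv_l s t u : equiv s t -> (equiv s u <-> equiv t u).
Proof.
  intros H. pose proof (Th_rewrite (Eq (Var 0) (tshift u)) s t H) as E.
  unfold instN in E; cbn in E. rewrite !instN_shift_l in E. exact E.
Qed.

Lemma equiv_sym s t : equiv s t -> equiv t s.
Proof. intros H. apply (equiv_l s t s H), equiv_refl. Qed.

Lemma equiv_trans s t u : equiv s t -> equiv t u -> equiv s u.
Proof. intros H H'. now apply (equiv_l s t u H). Qed.

(** Terms modulo provable equality, represented by chosen elements of the classes: the
    equality of the model is then the real one. *)
Definition canon (t : term) : term := epsilon (inhabits Zero) (equiv t).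

Lemma canon_equiv t : equiv t (canon t).
Proof. apply (epsilon_spec (inhabits Zero) (equiv t)). exists t; apply equiv_refl. Qed.

Lemma canon_eq s t : canon s = canon t <-> equiv s t.
Proof.
  split.
  - intros E. apply equiv_trans with (canon s); [apply canon_equiv|].
    rewrite E. apply equiv_sym, canon_equiv.
  - intros H. unfold canon. f_equal. apply functional_extensionality; intros u.
    apply propositional_extensionality, equiv_l, H.
Qed.

Definition class : Set := { t : term | canon t = t }.

Definition mk (t : term) : class :=
  exist _ (canon t) (proj2 (canon_eq _ _) (equiv_sym _ _ (canon_equiv t))).

Lemma mk_eq s t : mk s = mk t <-> equiv s t.
Proof.
  rewrite <- canon_eq. split; [intros E; exact (f_equal (@proj1_sig _ _) E)|].
  intros E; unfold mk; now apply subset_eq_compat.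
Qed.

Lemma mk_val (c : class) : mk (proj1_sig c) = c.
Proof. destruct c as [t E]; unfold mk; cbn; now apply subset_eq_compat. Qed.

Definition term_model : structure := {|
  num := class;
  set := nat;
  zero := mk Zero;
  one := mk One;
  add c d := mk (Plus (proj1_sig c) (proj1_sig d));
  mul c d := mk (Times (proj1_sig c) (proj1_sig d));
  lt c d := Th (Lt (proj1_sig c) (proj1_sig d));
  mem c X := Th (Mem (proj1_sig c) X)
|}.

Lemma equiv_canon_2 (op : term -> term -> term) s t :
  (forall sg s t, tsubst sg (op s t) = op (tsubst sg s) (tsubst sg t)) ->
  equiv (op (canon s) (canon t)) (op s t).
Proof.
  intros Hop. apply equiv_trans with (op s (canon t)).
  - pose proof (Th_rewrite (Eq (op (Var 0) (tshift (canon t))) (tshift (op s (canon t))))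
      s (canon s) (canon_equiv s)) as E.
    unfold instN in E; cbn in E. rewrite !instN_shift_l, !Hop, !instN_shift_l in E.
    cbn in E. apply E, equiv_refl.
  - pose proof (Th_rewrite (Eq (op (tshift s) (Var 0)) (tshift (op s t)))
      t (canon t) (canon_equiv t)) as E.
    unfold instN in E; cbn in E. rewrite !instN_shift_l, !Hop, !instN_shift_l in E.
    cbn in E. apply E, equiv_refl.
Qed.

Lemma eval_term_model (sg : nat -> term) t :
  eval term_model (fun n => mk (sg n)) t = mk (tsubst sg t).
Proof.
  induction t; cbn; try easy; rewrite IHt1, IHt2; apply mk_eq.
  - now apply (equiv_canon_2 Plus).
  - now apply (equiv_canon_2 Times).
Qed.

Lemma Th_Lt_canon s t : Th (Lt (canon s) (canon t)) <-> Th (Lt s t).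
Proof.
  pose proof (Th_rewrite (Lt (Var 0) (tshift (canon t))) _ _ (canon_equiv s)) as E.
  pose proof (Th_rewrite (Lt (tshift s) (Var 0)) _ _ (canon_equiv t)) as E'.
  unfold instN in E, E'; cbn in E, E'. rewrite !instN_shift_l in E, E'. tauto.
Qed.

Lemma Th_Mem_canon s X : Th (Mem (canon s) X) <-> Th (Mem s X).
Proof.
  pose proof (Th_rewrite (Mem (Var 0) X) _ _ (canon_equiv s)) as E.
  unfold instN in E; cbn in E. tauto.
Qed.

(** The truth lemma.  It is stated for instances of [A], since the variables of the model
    range over classes of terms and over set variables. *)
Lemma sat_term_model A : forall sg rh,
  sat term_model (fun n => mk (sg n)) rh A <-> Th (subst sg rh A).
Proof.
  induction A; intros sg rh; cbn; rewrite ?eval_term_model.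
  - split; [easy|]. now apply completion_bot.
  - apply mk_eq.
  - cbn. apply Th_Lt_canon.
  - cbn. apply Th_Mem_canon.
  - rewrite IHA1, IHA2, completion_imp; easy.
  - rewrite completion_allN by assumption.
    assert (E : forall t, sat term_model (scons (mk t) (fun n => mk (sg n))) rh A
                          <-> Th (instN (subst (upN sg) rh A) t)).
    { intros t. unfold instN; rewrite subst_subst.
      specialize (IHA (fun n => tsubst (fun n => match n with 0 => t | S n => Var n end)
                                  (upN sg n)) rh).
      rewrite <- IHA.
      replace (fun n => mk (tsubst _ (upN sg n))) with (scons (mk t) (fun n => mk (sg n)));
        [easy|].
      apply functional_extensionality; intros [|n]; cbn; [easy|].
      now rewrite instN_shift_l. }
    split; intros H.
    + intros t. apply E, H.
    + intros c. rewrite <- (mk_val c). apply E, H.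
  - rewrite completion_allS by assumption.
    split; intros H Y; specialize (H Y); specialize (IHA sg (scons Y rh)).
    + rewrite IHA in H. unfold instS; rewrite subst_subst.
      erewrite subst_eq; [exact H | | intros [|X]; reflexivity].
      intros n; apply tsubst_Var.
    + apply IHA. unfold instS in H; rewrite subst_subst in H.
      erewrite subst_eq; [exact H | | intros [|X]; reflexivity].
      intros n; symmetry; apply tsubst_Var.
Qed.

Lemma sat_term_model_val A rho eta :
  sat term_model rho eta A <-> Th (subst (fun n => proj1_sig (rho n)) eta A).
Proof.
  rewrite <- sat_term_model.
  replace (fun n => mk (proj1_sig (rho n))) with rho; [easy|].
  apply functional_extensionality; intros n; symmetry; apply mk_val.
Qed.

Lemma term_model_models : models term_model T.
Proof.
  intros A rho eta HA. apply sat_term_model_val, completion_ax, T_closed, HA.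
Qed.

End TermModel.

(** Gödel completeness: if [A] is not derivable, then its negation is consistent, and the
    term model of a completion of it refutes [A].  Closure of [T] under substitution
    makes its members with free variables behave as their universal closures. *)
Theorem completeness T A :
  subst_closed T ->
  (forall M rho eta, models M T -> sat M rho eta A) ->
  prv T [] A.
Proof.
  intros HT H. apply NNPP; intros HA.
  assert (HC : consistent T [Neg A]).
  { intros H'. apply HA. now apply prv_dne_bot. }
  set (M := term_model T [Neg A]).
  assert (HN : sat M (fun n => mk T [Neg A] (Var n)) (fun X => X) (Neg A)).
  { apply sat_term_model; [easy..|]. rewrite subst_Var. exists 0. now apply prv_hyp; left. }
  now apply HN, H, term_model_models.
Qed.

(** * RCA_0 is closed under substitution *)

Lemma delta0_subst A : delta0 A -> forall sg rh, delta0 (subst sg rh A).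
Proof.
  induction 1; intros sg rh; cbn.
  - constructor.
  - constructor.
  - constructor.
  - constructor.
  - now constructor.
  - rewrite tsubst_upN_tshift. now apply delta0_ball.
  - rewrite tsubst_upN_tshift. now apply delta0_bex.
Qed.

Lemma RCA0_subst_closed : subst_closed RCA0.
Proof.
  intros sg rh A [B HB|B HB|B C HB HC].
  - replace (subst sg rh B) with B; [now apply RCA0_semiring|].
    destruct HB; reflexivity.
  - cbn. rewrite subst_instN, subst_succN.
    apply (RCA0_induction (subst (upN sg) rh B)).
    destruct HB as [B HB]. apply sigma01_intro. now apply delta0_subst.
  - cbn. rewrite subst_shiftS.
    apply (RCA0_comprehension (subst (upN sg) rh B) (subst (upN sg) rh C)).
    + destruct HB as [B HB]. apply sigma01_intro. now apply delta0_subst.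
    + destruct HC as [C HC]. apply pi01_intro. now apply delta0_subst.
Qed.

Lemma NNPP_iff (P : Prop) : ~ ~ P <-> P.
Proof. split; [apply NNPP | tauto]. Qed.

(** * Arithmetic in a model *)

Section Model.
Variable M : structure.
Hypothesis HM : models M RCA0.
(* Formulas are evaluated in an environment for the set variables, which has to have
   values even if the formula has no set variables. *)
Variable some_set : set M.

Declare Scope M_scope.
Local Notation "0" := (zero M) : M_scope.
Local Notation "1" := (one M) : M_scope.
Local Notation "x + y" := (add M x y) : M_scope.
Local Notation "x * y" := (mul M x y) : M_scope.
Local Notation "x < y" := (lt M x y) : M_scope.
Local Notation "x <= y" := (lt M x y \/ x = y) : M_scope.
Local Notation "x ∈ X" := (mem M x X) (at level 70) : M_scope.
Local Open Scope M_scope.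

Local Notation sem H := (HM _ (fun _ => 0) (fun _ => some_set) (RCA0_semiring _ H)).

Lemma add_assoc a b c : (a + b) + c = a + (b + c).
Proof. exact (sem ax_addA a b c). Qed.
Lemma add_comm a b : a + b = b + a.
Proof. exact (sem ax_addC a b). Qed.
Lemma add_0_r a : a + 0 = a.
Proof. exact (sem ax_add0 a). Qed.
Lemma mul_assoc a b c : (a * b) * c = a * (b * c).
Proof. exact (sem ax_mulA a b c). Qed.
Lemma mul_comm a b : a * b = b * a.
Proof. exact (sem ax_mulC a b). Qed.
Lemma mul_1_r a : a * 1 = a.
Proof. exact (sem ax_mul1 a). Qed.
Lemma mul_0_r a : a * 0 = 0.
Proof. exact (sem ax_mul0 a). Qed.
Lemma mul_add_r a b c : a * (b + c) = a * b + a * c.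
Proof. exact (sem ax_mulD a b c). Qed.
Lemma lt_irrefl a : ~ a < a.
Proof. exact (sem ax_lt_irr a). Qed.
Lemma lt_trans a b c : a < b -> b < c -> a < c.
Proof. intros H H'. apply (sem ax_lt_trans a b c); cbn; tauto. Qed.
Lemma lt_total a b : a < b \/ a = b \/ b < a.
Proof. pose proof (sem ax_lt_total a b) as H; cbn in H; tauto. Qed.
Lemma lt_add_r a b c : a < b -> a + c < b + c.
Proof. exact (sem ax_lt_add a b c). Qed.
Lemma lt_mul_r a b c : 0 < c -> a < b -> a * c < b * c.
Proof. intros H H'. apply (sem ax_lt_mul a b c); cbn; tauto. Qed.
Lemma lt_sub a b : a < b -> exists c, a + c = b.
Proof.
  intros H. pose proof (sem ax_sub a b H) as H'; cbn in H'.
  apply NNPP; intros N; apply H'; intros c E; apply N; now exists c.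
Qed.
Lemma zero_le a : 0 <= a.
Proof. pose proof (sem ax_0_least a) as H; cbn in H; tauto. Qed.
Lemma lt_0_1 : 0 < 1.
Proof. exact (sem ax_0_lt_1). Qed.
Lemma discrete a : 0 < a -> 1 <= a.
Proof. intros H; pose proof (sem ax_discrete a H) as H'; cbn in H'; tauto. Qed.

Lemma M_semi_ring : semi_ring_theory 0 1 (add M) (mul M) eq.
Proof.
  split; intros.
  - rewrite add_comm; apply add_0_r.
  - apply add_comm.
  - now rewrite add_assoc.
  - rewrite mul_comm; apply mul_1_r.
  - rewrite mul_comm; apply mul_0_r.
  - apply mul_comm.
  - now rewrite mul_assoc.
  - rewrite !(mul_comm _ p). apply mul_add_r.
Qed.
Add Ring M_ring : M_semi_ring.

Lemma lt_succ a : a < a + 1.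
Proof.
  replace a with (0 + a) at 1 by ring. rewrite (add_comm a 1). apply lt_add_r, lt_0_1.
Qed.

Lemma lt_succ_r a b : a < b + 1 -> a <= b.
Proof.
  intros H. destruct (lt_total a b) as [?|[?|H']]; auto. exfalso.
  destruct (lt_sub _ _ H') as [c <-].
  destruct (zero_le c) as [Hc| <-].
  - apply discrete in Hc as [Hc| <-].
    + apply (lt_add_r _ _ b) in Hc. rewrite !(add_comm _ b) in Hc.
      exact (lt_irrefl _ (lt_trans _ _ _ H Hc)).
    + exact (lt_irrefl _ H).
  - rewrite add_0_r in H'. exact (lt_irrefl _ H').
Qed.

Lemma not_lt_0 a : ~ a < 0.
Proof.
  intros H. destruct (zero_le a) as [H'| <-].
  - exact (lt_irrefl _ (lt_trans _ _ _ H H')).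
  - exact (lt_irrefl _ H).
Qed.

(** [ord] refutes the negated goal by case analysis and by closing the hypotheses under
    transitivity of the strict order, using a < a + 1 and discreteness.  It knows nothing
    about sums other than successors. *)
Ltac fact H T := lazymatch goal with _ : T |- _ => fail | _ => assert (T) by exact H end.
Ltac ord :=
  intros; apply NNPP; intro;
  repeat match goal with
  | H : ?a < ?a |- _ => exact (False_ind _ (lt_irrefl _ H))
  | H : ?a < 0 |- _ => exact (False_ind _ (not_lt_0 _ H))
  | H : ?a <> ?a |- _ => exact (False_ind _ (H eq_refl))
  | H : ?P, H' : ~ ?P |- _ => exact (False_ind _ (H' H))
  | H : ~ (_ \/ _) |- _ => apply not_or_and in H as []
  | H : ~ (_ /\ _) |- _ => apply not_and_or in H
  | H : ~ ~ _ |- _ => apply NNPP in H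
  | H : _ /\ _ |- _ => destruct H
  | H : context [?a + 1] |- _ => fact (lt_succ a) (a < a + 1)
  | H : ?a = ?b |- _ => first
      [ subst a | subst b
      | lazymatch b with context [a] => rewrite <- H in * | _ => rewrite H in * end; clear H ]
  | H : ~ ?a < ?b |- _ => destruct (lt_total a b) as [?|[?|?]]; [contradiction| |]; clear H
  | H : ?a < ?b, H' : ?b < ?c |- _ => fact (lt_trans _ _ _ H H') (a < c)
  | H : ?a < ?b + 1 |- _ =>
      tryif constr_eq a b then fail else
      lazymatch goal with
      | _ : a < b |- _ => fail
      | _ => destruct (lt_succ_r _ _ H)
      end
  | H : _ \/ _ |- _ => destruct H
  end.

Lemma add_cancel_r a b c : a + c = b + c -> a = b.
Proof.
  intros E. destruct (lt_total a b) as [L|[?|L]]; [|easy|];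
    apply (lt_add_r _ _ c) in L; rewrite E in L; now apply lt_irrefl in L.
Qed.

Lemma lt_sub' a b : a < b -> exists c, 0 < c /\ a + c = b.
Proof.
  intros L. destruct (lt_sub _ _ L) as [c <-]. exists c; split; [|easy].
  destruct (zero_le c) as [?| <-]; [easy|]. rewrite add_0_r in L. now apply lt_irrefl in L.
Qed.

Lemma le_sub a b : a <= b -> exists c, a + c = b.
Proof. intros [L| ->]; [now apply lt_sub | exists 0; apply add_0_r]. Qed.

Lemma pos_succ a : 0 < a -> exists b, b + 1 = a.
Proof.
  intros L. apply discrete, le_sub in L as [b <-]. exists b; apply add_comm.
Qed.

Lemma le_add a b : a <= a + b.
Proof.
  destruct (zero_le b) as [L| <-]; [left | right; now rewrite add_0_r].
  apply (lt_add_r _ _ a) in L. replace (0 + a) with a in L by ring.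
  now rewrite add_comm.
Qed.

Lemma mul_pos a b : 0 < a -> 0 < b -> 0 < a * b.
Proof.
  intros Ha Hb. apply (lt_mul_r _ _ b Hb) in Ha. now replace (0 * b) with 0 in Ha by ring.
Qed.

Definition pair (a b : num M) : num M := (a + b) * (a + b) + a.

(** * Definable predicates *)

(** A predicate on environments is definable if a formula expresses it once every
    variable of the formula is read either as an entry of the environment or as a
    constant.  Working with predicates instead of formulas lets definability be proved by
    recursion on a statement as it is written, with parameters left in place. *)

Local Notation env := (nat -> num M).

Record context := {
  cnum : nat -> nat + num M;
  cset : nat -> set M
}.

Definition look (rho : env) (s : nat + num M) : num M :=
  match s with inl i => rho i | inr c => c end.

Definition inst (k : context) (rho : env) : env := fun n => look rho (cnum k n).

Definition tdef (t : env -> num M) : Prop :=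
  exists u k, forall rho, eval M (inst k rho) u = t rho.

Definition D0 (P : env -> Prop) : Prop :=
  exists A k, delta0 A /\ forall rho, sat M (inst k rho) (cset k) A <-> P rho.

Definition merge {X : Type} (f g : nat -> X) (n : nat) : X :=
  if Nat.even n then f (Nat.div2 n) else g (Nat.div2 n).

Definition evens n := (2 * n)%nat.
Definition odds n := S (2 * n).

Lemma merge_evens {X : Type} (f g : nat -> X) : (fun n => merge f g (evens n)) = f.
Proof.
  apply functional_extensionality; intros n; unfold merge, evens.
  rewrite Nat.even_mul; cbn [Nat.even orb]. now rewrite Nat.div2_double.
Qed.

Lemma merge_odds {X : Type} (f g : nat -> X) : (fun n => merge f g (odds n)) = g.
Proof.
  apply functional_extensionality; intros n; unfold merge, odds.
  rewrite Nat.even_succ, <- Nat.negb_even, Nat.even_mul; cbn [Nat.even orb negb].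
  now rewrite Nat.div2_succ_double.
Qed.

Definition cmerge (k k' : context) : context :=
  {| cnum := merge (cnum k) (cnum k'); cset := merge (cset k) (cset k') |}.

Lemma inst_evens k k' rho : (fun n => inst (cmerge k k') rho (evens n)) = inst k rho.
Proof.
  apply functional_extensionality; intros n. unfold inst; cbn [cmerge cnum].
  pose proof (equal_f (merge_evens (cnum k) (cnum k')) n) as E; cbv beta in E. now rewrite E.
Qed.

Lemma inst_odds k k' rho : (fun n => inst (cmerge k k') rho (odds n)) = inst k' rho.
Proof.
  apply functional_extensionality; intros n. unfold inst; cbn [cmerge cnum].
  pose proof (equal_f (merge_odds (cnum k) (cnum k')) n) as E; cbv beta in E. now rewrite E.
Qed.

(** Two terms or formulas get common parameters by moving their variables to the even and
    to the odd positions. *)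
Lemma tdef_common t t' : tdef t -> tdef t' ->
  exists u u' k, (forall rho, eval M (inst k rho) u = t rho)
              /\ (forall rho, eval M (inst k rho) u' = t' rho).
Proof.
  intros [u [k H]] [u' [k' H']].
  exists (tsubst (fun n => Var (evens n)) u), (tsubst (fun n => Var (odds n)) u'),
    (cmerge k k').
  split; intros rho; rewrite eval_tsubst; cbn [eval];
    rewrite ?inst_evens, ?inst_odds; auto.
Qed.

Lemma D0_common P P' : D0 P -> D0 P' ->
  exists A A' k, delta0 A /\ delta0 A'
    /\ (forall rho, sat M (inst k rho) (cset k) A <-> P rho)
    /\ (forall rho, sat M (inst k rho) (cset k) A' <-> P' rho).
Proof.
  intros [A [k [HA H]]] [A' [k' [HA' H']]].
  exists (subst (fun n => Var (evens n)) evens A), (subst (fun n => Var (odds n)) odds A'),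
    (cmerge k k').
  split; [now apply delta0_subst|]. split; [now apply delta0_subst|].
  split; intros rho; rewrite sat_subst; cbn [eval cset cmerge];
    rewrite ?inst_evens, ?inst_odds, ?merge_evens, ?merge_odds; auto.
Qed.

Lemma tdef_var i : tdef (fun rho => rho i).
Proof.
  exists (Var i), {| cnum := inl; cset := fun _ => some_set |}. reflexivity.
Qed.

Lemma tdef_const c : tdef (fun _ => c).
Proof.
  exists (Var O), {| cnum := fun _ => inr c; cset := fun _ => some_set |}. reflexivity.
Qed.

Lemma tdef_add t t' : tdef t -> tdef t' -> tdef (fun rho => t rho + t' rho).
Proof.
  intros H H'. destruct (tdef_common _ _ H H') as (u & u' & k & E & E').
  exists (Plus u u'), k; intros rho; cbn; congruence.
Qed.

Lemma tdef_mul t t' : tdef t -> tdef t' -> tdef (fun rho => t rho * t' rho).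
Proof.
  intros H H'. destruct (tdef_common _ _ H H') as (u & u' & k & E & E').
  exists (Times u u'), k; intros rho; cbn; congruence.
Qed.

Lemma D0_ext P P' : (forall rho, P rho <-> P' rho) -> D0 P -> D0 P'.
Proof.
  intros E (A & k & HA & H). exists A, k; split; [easy|]; intros; now rewrite <- E.
Qed.

Lemma D0_eq t t' : tdef t -> tdef t' -> D0 (fun rho => t rho = t' rho).
Proof.
  intros H H'. destruct (tdef_common _ _ H H') as (u & u' & k & E & E').
  exists (Eq u u'), k; split; [constructor|]; intros rho; cbn; now rewrite E, E'.
Qed.

Lemma D0_lt t t' : tdef t -> tdef t' -> D0 (fun rho => t rho < t' rho).
Proof.
  intros H H'. destruct (tdef_common _ _ H H') as (u & u' & k & E & E').
  exists (Lt u u'), k; split; [constructor|]; intros rho; cbn; now rewrite E, E'.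
Qed.

Lemma D0_mem t X : tdef t -> D0 (fun rho => t rho ∈ X).
Proof.
  intros (u & k & E).
  exists (Mem u O), {| cnum := cnum k; cset := fun _ => X |}; split; [constructor|].
  intros rho; cbn. now rewrite <- E.
Qed.

Lemma D0_imp P P' : D0 P -> D0 P' -> D0 (fun rho => P rho -> P' rho).
Proof.
  intros H H'. destruct (D0_common _ _ H H') as (A & A' & k & HA & HA' & E & E').
  exists (Imp A A'), k; split; [now constructor|]; intros rho; cbn; now rewrite E, E'.
Qed.

Lemma D0_not P : D0 P -> D0 (fun rho => ~ P rho).
Proof.
  intros (A & k & HA & H). exists (Neg A), k; split; [now repeat constructor|].
  intros rho; cbn; now rewrite H.
Qed.

Lemma D0_and P P' : D0 P -> D0 P' -> D0 (fun rho => P rho /\ P' rho).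
Proof.
  intros H H'. apply D0_ext with (fun rho => ~ (P rho -> ~ P' rho)); [intros; tauto|].
  now apply D0_not, D0_imp, D0_not.
Qed.

Lemma D0_or P P' : D0 P -> D0 P' -> D0 (fun rho => P rho \/ P' rho).
Proof.
  intros H H'. apply D0_ext with (fun rho => ~ P rho -> P' rho); [intros; tauto|].
  now apply D0_imp, H'; apply D0_not.
Qed.

Lemma D0_subst P (e : nat -> nat + num M) : D0 P -> D0 (fun rho => P (fun n => look rho (e n))).
Proof.
  intros (A & k & HA & H).
  exists A, {| cnum n := match cnum k n with inl i => e i | inr c => inr c end; cset := cset k |}.
  split; [easy|]. intros rho. rewrite <- H.
  replace (inst k _) with (inst {| cnum n := match cnum k n with inl i => e i | inr c => inr c end;
    cset := cset k |} rho); [easy|].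
  apply functional_extensionality; intros n; unfold inst; cbn. now destruct (cnum k n).
Qed.

Lemma D0_ball t P : tdef t -> D0 (fun rho => P (fun n => rho (S n)) (rho O)) ->
  D0 (fun rho => forall x, x < t rho -> P rho x).
Proof.
  intros (u & k & Hu) (A & k' & HA & H).
  set (th n := match cnum k' n with inl O => O | _ => S n end).
  set (k1 := {| cnum n := match cnum k' n with inl (S i) => inl i | inl O => inr 0 | inr c => inr c end;
                cset := cset k' |}).
  exists (AllN (Imp (Lt (Var O) (tshift (tsubst (fun n => Var (evens n)) u)))
    (subst (upN (fun n => Var (odds n))) odds (subst (fun n => Var (th n)) (fun X => X) A)))),
    (cmerge k k1).
  split; [now apply delta0_ball, delta0_subst, delta0_subst|].
  intros rho. apply sat_AllN; intros x. apply sat_Imp.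
  - unfold tshift; cbn. rewrite !eval_tsubst; cbn [eval scons].
    now rewrite inst_evens, Hu.
  - rewrite sat_subst, scons_upN; cbn [eval]. rewrite inst_odds.
    cbn [cset cmerge]. rewrite merge_odds, sat_subst; cbn [eval].
    replace (fun n => scons x (inst k1 rho) (th n)) with (inst k' (scons x rho)); [apply H|].
    apply functional_extensionality; intros n; unfold th, inst.
    destruct (cnum k' n) as [[|i]|c] eqn:E; cbn; rewrite ?E; reflexivity.
Qed.

Lemma D0_bex t P : tdef t -> D0 (fun rho => P (fun n => rho (S n)) (rho O)) ->
  D0 (fun rho => exists x, x < t rho /\ P rho x).
Proof.
  intros Ht H. apply D0_ext with (fun rho => ~ forall x, x < t rho -> ~ P rho x).
  - intros rho; split; [|firstorder].
    intros N; apply NNPP; intros N'; apply N; intros x Hx HP; apply N'; now exists x.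
  - apply D0_not. apply D0_ball; [easy|]. now apply D0_not.
Qed.

Lemma tdef_pair t t' : tdef t -> tdef t' -> tdef (fun rho => pair (t rho) (t' rho)).
Proof. intros; unfold pair; repeat first [apply tdef_add | apply tdef_mul]; assumption. Qed.

Definition Sig (P : env -> Prop) : Prop :=
  exists Q, D0 Q /\ forall rho, P rho <-> exists x, Q (scons x rho).

Definition Pi (P : env -> Prop) : Prop := Sig (fun rho => ~ P rho).

Lemma Sig_ext P P' : (forall rho, P rho <-> P' rho) -> Sig P -> Sig P'.
Proof. intros E (Q & HQ & H). exists Q; split; [easy|]; intros; now rewrite <- E. Qed.

Lemma Sig_D0 P : D0 P -> Sig P.
Proof.
  intros H. exists (fun rho => P (fun n => rho (S n))); split.
  - exact (D0_subst P (fun n => inl (S n)) H).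
  - intros rho; split; [intros HP; now exists 0 | now intros [x HP]].
Qed.

(** Two unbounded existential quantifiers are contracted to one that bounds both. *)
Lemma Sig_ex P : Sig (fun rho => P (fun n => rho (S n)) (rho O)) ->
  Sig (fun rho => exists x, P rho x).
Proof.
  intros (Q & HQ & H).
  exists (fun rho => exists x, x < rho O /\ exists y, y < rho O
            /\ Q (scons y (scons x (fun n => rho (S n))))). split.
  - apply D0_bex; [apply tdef_var|]. apply D0_bex; [apply tdef_var|]. cbn.
    apply D0_ext with (2 := D0_subst Q
      (fun n => match n with O => inl O | S O => inl 1%nat | S (S n) => inl (S (S (S n))) end) HQ).
    intros rho. replace (fun n => look _ _)
      with (scons (rho O) (scons (rho 1%nat) (fun n => rho (S (S (S n)))))); [easy|].
    now apply functional_extensionality; intros [|[|n]].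
  - intros rho; split.
    + intros [x Hx]. apply (H (scons x rho)) in Hx as [y Hy].
      destruct (lt_total x y) as [L|[<-|L]].
      * exists (y + 1), x; split; [cbn; ord|]. exists y; split; [cbn; ord | exact Hy].
      * exists (x + 1), x; split; [cbn; ord|]. exists x; split; [cbn; ord | exact Hy].
      * exists (x + 1), x; split; [cbn; ord|]. exists y; split; [cbn; ord | exact Hy].
    + intros (z & x & _ & y & _ & Hy). exists x. apply (H (scons x rho)). now exists y.
Qed.

Lemma Pi_D0 P : D0 P -> Pi P.
Proof. intros H. now apply Sig_D0, D0_not. Qed.

Lemma Pi_all P : Pi (fun rho => P (fun n => rho (S n)) (rho O)) ->
  Pi (fun rho => forall x, P rho x).
Proof.
  intros H. apply Sig_ext with (fun rho => exists x, ~ P rho x).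
  - intros rho; split; [firstorder | apply not_all_ex_not].
  - now apply Sig_ex.
Qed.

Definition env0 : env := fun _ => 0.

(** The matrices of normal forms: binary, and applicable to any two variables. *)
Definition rel0 (th : num M -> num M -> Prop) : Prop := D0 (fun rho => th (rho O) (rho 1%nat)).

Lemma rel0_at th i j : rel0 th -> D0 (fun rho => th (rho i) (rho j)).
Proof.
  exact (D0_subst (fun rho => th (rho O) (rho 1%nat))
    (fun n => match n with O => inl i | _ => inl j end)).
Qed.

Lemma Sig_rel0 Phi : Sig (fun rho => Phi (rho O)) ->
  exists th, rel0 th /\ forall n, Phi n <-> exists x, th n x.
Proof.
  intros (Q & HQ & H). exists (fun n x => Q (scons x (scons n env0))); split.
  - apply D0_ext with (2 := D0_subst Q
      (fun n => match n with O => inl 1%nat | S O => inl O | _ => inr 0 end) HQ).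
    intros rho. replace (fun n => look _ _) with (scons (rho 1%nat) (scons (rho O) env0)); [easy|].
    now apply functional_extensionality; intros [|[|n]].
  - intros n. apply (H (scons n env0)).
Qed.

Ltac tdef_tac :=
  cbv beta;
  lazymatch goal with
  | |- tdef (fun rho => pair _ _) => apply tdef_pair; tdef_tac
  | |- tdef (fun rho => _ + _) => apply tdef_add; tdef_tac
  | |- tdef (fun rho => _ * _) => apply tdef_mul; tdef_tac
  | |- _ => first [apply tdef_const | apply tdef_var]
  end.

Ltac D0_tac :=
  cbv beta;
  lazymatch goal with
  | |- D0 (fun rho => _ = _) => apply D0_eq; tdef_tac
  | |- D0 (fun rho => _ < _) => apply D0_lt; tdef_tac
  | |- D0 (fun rho => _ ∈ _) => apply D0_mem; tdef_tac
  | |- D0 (fun rho => ~ _) => apply D0_not; D0_tac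
  | |- D0 (fun rho => _ /\ _) => apply D0_and; D0_tac
  | |- D0 (fun rho => _ \/ _) => apply D0_or; D0_tac
  | |- D0 (fun rho => exists x, x < _ /\ _) => apply D0_bex; [tdef_tac | D0_tac]
  | |- D0 (fun rho => forall x, x < _ -> _) => apply D0_ball; [tdef_tac | D0_tac]
  | |- D0 (fun rho => _ -> _) => apply D0_imp; D0_tac
  | |- _ => apply rel0_at; assumption
  end.

Ltac Sig_tac :=
  cbv beta;
  first [ apply Sig_D0; solve [D0_tac] | apply Sig_ex; Sig_tac ].
Ltac Pi_tac :=
  cbv beta;
  first [ apply Pi_D0; solve [D0_tac] | apply Pi_all; Pi_tac ].

(** * Induction and comprehension *)

(** The link to the axiom schemes, where number variable 1 is the variable of the scheme
    and number variable 0 the quantified one.  Two matrices share one parameter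
    environment because comprehension takes a Sigma and a Pi formula together. *)
Lemma rel0_formula th th' : rel0 th -> rel0 th' ->
  exists A A' rho eta, delta0 A /\ delta0 A'
  /\ (forall x n, sat M (scons x (scons n rho)) eta A <-> th n x)
  /\ (forall x n, sat M (scons x (scons n rho)) eta A' <-> th' n x).
Proof.
  intros H H'. destruct (D0_common _ _ H H') as (A & A' & k & HA & HA' & E & E').
  set (e n := match cnum k n with inl O => 1%nat | inl (S O) => O | _ => S (S n) end).
  set (rho n := match cnum k n with inl _ => 0 | inr c => c end).
  assert (He : forall x n, (fun i => scons x (scons n rho) (e i))
                            = inst k (scons n (scons x env0))).
  { intros x n. apply functional_extensionality; intros i; unfold e, inst.
    destruct (cnum k i) as [[|[|j]]|c] eqn:Ei; cbn; unfold rho; rewrite ?Ei; reflexivity. }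
  exists (subst (fun n => Var (e n)) (fun X => X) A),
    (subst (fun n => Var (e n)) (fun X => X) A'), rho, (cset k).
  split; [now apply delta0_subst|]. split; [now apply delta0_subst|].
  split; intros x n; rewrite sat_subst; cbn [eval]; rewrite He; [apply E | apply E'].
Qed.

Lemma Sig_induction (Phi : num M -> Prop) : Sig (fun rho => Phi (rho O)) ->
  Phi 0 -> (forall n, Phi n -> Phi (n + 1)) -> forall n, Phi n.
Proof.
  intros HP H0 HS. destruct (Sig_rel0 _ HP) as (th & Hth & H).
  destruct (rel0_formula _ _ Hth Hth) as (A & _ & rho & eta & HA & _ & E & _).
  assert (EA : forall n, sat M (scons n rho) eta (ExN A) <-> Phi n).
  { intros n. rewrite H. now apply sat_ExN. }
  pose proof (HM _ rho eta (RCA0_induction _ (sigma01_intro A HA))) as I.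
  assert (I' : forall n, sat M (scons n rho) eta (ExN A)).
  { apply I. apply (sat_And M rho eta _ _ _ _ (iff_refl _) (iff_refl _)). split.
    - apply sat_subst.
      replace (fun n => eval M rho _) with (scons 0 rho); [now apply EA|].
      now apply functional_extensionality; intros [|n].
    - intros n Hn. apply sat_subst.
      replace (fun i => eval M (scons n rho) _) with (scons (n + 1) rho).
      + now apply EA, HS, EA.
      + now apply functional_extensionality; intros [|i]. }
  intros n. now apply EA, I'.
Qed.

Lemma D1_comprehension (Phi : num M -> Prop) :
  Sig (fun rho => Phi (rho O)) -> Pi (fun rho => Phi (rho O)) ->
  exists X, forall n, n ∈ X <-> Phi n.
Proof.
  intros HS HP. destruct (Sig_rel0 _ HS) as (th & Hth & H).
  destruct (Sig_rel0 (fun n => ~ Phi n) HP) as (th' & Hth' & H').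
  destruct (rel0_formula _ _ Hth Hth') as (A & A' & rho & eta & HA & HA' & E & E').
  assert (EA : forall n, sat M (scons n rho) eta (ExN A) <-> Phi n).
  { intros n. rewrite H. now apply sat_ExN. }
  assert (EA' : forall n, sat M (scons n rho) eta (AllN (Neg A')) <-> Phi n).
  { intros n. transitivity (forall x, ~ th' n x).
    - apply sat_AllN; intros x. apply sat_Neg, E'.
    - rewrite <- (NNPP_iff (Phi n)), H'. firstorder. }
  pose proof (HM _ rho eta (RCA0_comprehension _ _ (sigma01_intro A HA)
    (pi01_intro _ (delta0_imp _ _ HA' delta0_bot)))) as C.
  eapply sat_ExS; [|apply C].
  - intros X. apply sat_AllN; intros n. apply sat_Iff; [apply iff_refl|].
    unfold shiftS; rewrite sat_subst; cbn [eval scons]. apply EA.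
  - intros n. apply (sat_Iff M _ _ _ _ (Phi n) (Phi n)); [apply EA | apply EA' | easy].
Qed.

(** If [Phi] fails at [a], then by induction on x it fails at a - x, which is a Sigma
    statement, and so at 0. *)
Lemma Pi_induction (Phi : num M -> Prop) : Pi (fun rho => Phi (rho O)) ->
  Phi 0 -> (forall n, Phi n -> Phi (n + 1)) -> forall n, Phi n.
Proof.
  intros HP H0 HS a. destruct (Sig_rel0 (fun n => ~ Phi n) HP) as (th & Hth & H).
  apply NNPP; intros Ha.
  assert (HI : forall x, exists y z, x <= a -> y + x = a /\ th y z).
  { apply Sig_induction.
    - Sig_tac.
    - destruct (proj1 (H a) Ha) as [z Hz]. exists a, z; split; [ring | easy].
    - intros x (y & z & Hyz). destruct (classic (x + 1 <= a)) as [L|L].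
      + destruct Hyz as [Hy Hz]; [ord|].
        assert (Hn : ~ Phi y) by (apply H; now exists z).
        destruct (zero_le y) as [Hp| <-]; [|contradiction].
        destruct (pos_succ _ Hp) as [v <-].
        assert (Hv : ~ Phi v) by (intros Hv; now apply Hn, HS).
        destruct (proj1 (H v) Hv) as [z' Hz'].
        exists v, z'; split; [|easy]. rewrite <- Hy; ring.
      + exists 0, 0; intros; contradiction. }
  destruct (HI a) as (y & z & Hyz). destruct Hyz as [Hy Hz]; [now right|].
  assert (Hn : ~ Phi y) by (apply H; now exists z).
  apply Hn. replace y with 0; [exact H0|].
  apply (add_cancel_r _ _ a). rewrite Hy. ring.
Qed.

Lemma least_Sig (Phi : num M -> Prop) : Sig (fun rho => Phi (rho O)) ->
  (exists n, Phi n) -> exists n, Phi n /\ forall m, m < n -> ~ Phi m.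
Proof.
  intros HP [n Hn]. destruct (Sig_rel0 _ HP) as (th & Hth & H).
  apply NNPP; intros N.
  assert (HI : forall v m x, m < v -> ~ th m x).
  { apply (Pi_induction (fun v => forall m x, m < v -> ~ th m x)).
    - Pi_tac.
    - intros m x L; now apply not_lt_0 in L.
    - intros v HI m x L Hx. apply N. exists v; split.
      + apply H. destruct (lt_succ_r _ _ L) as [L'| <-]; [|now exists x].
        now destruct (HI m x L').
      + intros w L' Hw. apply H in Hw as [y Hy]. now apply (HI w y). }
  destruct (proj1 (H n) Hn) as [x Hx]. exact (HI (n + 1) n x (lt_succ n) Hx).
Qed.

Lemma strong_Pi_induction (Phi : num M -> Prop) : Pi (fun rho => Phi (rho O)) ->
  (forall n, (forall m, m < n -> Phi m) -> Phi n) -> forall n, Phi n.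
Proof.
  intros HP HS n. apply NNPP; intros N.
  destruct (least_Sig (fun n => ~ Phi n) HP (ex_intro _ n N)) as (m & Hm & Hleast).
  apply Hm, HS. intros w L. apply NNPP; now apply Hleast.
Qed.

Lemma least_Pi (Phi : num M -> Prop) : Pi (fun rho => Phi (rho O)) ->
  (exists n, Phi n) -> exists n, Phi n /\ forall m, m < n -> ~ Phi m.
Proof.
  intros HP [n Hn]. destruct (Sig_rel0 (fun n => ~ Phi n) HP) as (th & Hth & H).
  apply NNPP; intros N.
  (* The witnesses against all smaller values are bounded, to keep the formula Sigma. *)
  assert (HI : forall v, exists b, forall m, m < v -> exists x, x < b /\ th m x).
  { apply Sig_induction.
    - Sig_tac.
    - exists 0; intros m L; now apply not_lt_0 in L.
    - intros v [b Hb].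
      assert (Hv : ~ Phi v).
      { intros Hv. apply N. exists v; split; [easy|]. intros m L.
        destruct (Hb m L) as (x & _ & Hx). apply H. now exists x. }
      apply H in Hv as [y Hy].
      assert (B : exists b', b <= b' /\ y < b').
      { destruct (classic (y < b)); [exists b | exists (y + 1)]; ord. }
      destruct B as (b' & B & B'). exists b'. intros m L.
      destruct (lt_succ_r _ _ L) as [L'| ->]; [|now exists y].
      destruct (Hb m L') as (x & L'' & Hx). exists x; split; [ord | easy]. }
  destruct (HI (n + 1)) as [b Hb]. destruct (Hb n (lt_succ n)) as (x & _ & Hx).
  apply (H n); [now exists x | exact Hn].
Qed.

Lemma Sig_collection th : rel0 th -> forall c,
  (forall i, i < c -> exists x, th i x) ->
  exists b, forall i, i < c -> exists x, x < b /\ th i x.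
Proof.
  intros Hth c Hc.
  assert (HI : forall v, exists b, forall i, i < v -> i < c -> exists x, x < b /\ th i x).
  { apply Sig_induction.
    - Sig_tac.
    - exists 0; intros m L; now apply not_lt_0 in L.
    - intros v [b Hb]. destruct (classic (v < c)) as [Lv|Lv].
      + destruct (Hc v Lv) as [y Hy].
        assert (B : exists b', b <= b' /\ y < b').
        { destruct (classic (y < b)); [exists b | exists (y + 1)]; ord. }
        destruct B as (b' & B & B'). exists b'. intros i L Lc.
        destruct (lt_succ_r _ _ L) as [L'| ->]; [|now exists y].
        destruct (Hb i L' Lc) as (x & L'' & Hx). exists x; split; [ord | easy].
      + exists b. intros i L Lc. apply Hb; [|easy].
        destruct (lt_succ_r _ _ L) as [L'| ->]; [easy | contradiction]. }
  destruct (HI c) as [b Hb]. exists b; auto.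
Qed.

(** * Strong bounding *)

(** Divisibility with a bounded witness, so that it is [D0]. *)

Definition dvd (a b : num M) : Prop := exists w, w < b + 1 /\ b = a * w.

Lemma dvd_intro a b w : 0 < a -> b = a * w -> dvd a b.
Proof.
  intros Ha ->. exists w; split; [|easy].
  destruct (pos_succ _ Ha) as [v <-].
  pose proof (le_add w (v * w)) as L. replace (w + v * w) with ((v + 1) * w) in L by ring.
  revert L; generalize ((v + 1) * w); ord.
Qed.

Lemma dvd_mul a b c : 0 < a -> dvd a b -> dvd a (b * c).
Proof. intros Ha (w & _ & ->). apply (dvd_intro _ _ (w * c)); [easy | ring]. Qed.

Lemma dvd_add_cancel a b c : 0 < a -> dvd a b -> dvd a (b + c) -> dvd a c.
Proof.
  intros Ha (x & _ & Hx) (y & _ & Hy). rewrite Hx in Hy.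
  assert (L : x <= y).
  { destruct (lt_total x y) as [?|[?|L]]; auto. exfalso.
    apply (lt_mul_r _ _ a Ha) in L. pose proof (le_add (x * a) c) as L'.
    replace (x * a) with (a * x) in * by ring. rewrite Hy in *.
    replace (y * a) with (a * y) in * by ring. ord. }
  apply le_sub in L as [z <-]. apply (dvd_intro _ _ z Ha).
  apply (add_cancel_r _ _ (a * x)). rewrite (add_comm c), Hy. ring.
Qed.

Lemma common_multiple c : exists m, 0 < m /\ forall e, e < c -> 0 < e -> dvd e m.
Proof.
  revert c. apply Sig_induction.
  - unfold dvd; Sig_tac.
  - exists 1; split; [apply lt_0_1|]. intros e L; now apply not_lt_0 in L.
  - intros c (m & Hm & H). destruct (zero_le c) as [Hc| <-].
    + exists (m * c); split; [now apply mul_pos|]. intros e L He.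
      destruct (lt_succ_r _ _ L) as [L'| ->].
      * now apply dvd_mul, H.
      * apply (dvd_intro _ _ m); [easy | ring].
    + exists m; split; [easy|]. intros e L He. ord.
Qed.

Section Coding.
Variables c m : num M.
Hypothesis m_pos : 0 < m.
Hypothesis m_multiple : forall e, e < c -> 0 < e -> dvd e m.

(** The moduli of Gödel's beta function, pairwise coprime for arguments below [c]. *)
Definition modulus (i : num M) : num M := 1 + (i + 1) * m.

Lemma modulus_gt_1 i : 1 < modulus i.
Proof.
  unfold modulus. pose proof (zero_le i) as L.
  assert (H : 0 < (i + 1) * m) by (apply mul_pos; [ord | easy]).
  apply (lt_add_r _ _ 1) in H. replace (0 + 1) with 1 in H by ring.
  now rewrite (add_comm 1).
Qed.

Lemma modulus_pos i : 0 < modulus i.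
Proof. exact (lt_trans _ _ _ lt_0_1 (modulus_gt_1 i)). Qed.

(** The modulus of j is coprime to m, and e divides m. *)
Lemma dvd_modulus_aux j e v : 0 < e -> e < c -> dvd (modulus j) (e * v) -> dvd (modulus j) v.
Proof.
  intros He Hc H. pose proof (modulus_pos j) as Hj.
  destruct (m_multiple e Hc He) as (q & _ & Hq).
  apply (dvd_add_cancel _ ((j + 1) * m * v)); [easy| |].
  - replace ((j + 1) * m * v) with ((e * v) * (q * (j + 1))) by (rewrite Hq; ring).
    now apply dvd_mul.
  - apply (dvd_intro _ _ v Hj). unfold modulus; ring.
Qed.

(** Write p_i for the modulus of i.  For i < j, the difference of (j + 1) p_i and (i + 1) p_j
    is j - i, so p_j divides (j - i) v, and j - i can be cancelled. *)
Lemma dvd_modulus_mul i j v : i < c -> j < c -> i <> j ->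
  dvd (modulus j) (modulus i * v) -> dvd (modulus j) v.
Proof.
  intros Hi Hj Hij H. pose proof (modulus_pos j) as Hp.
  assert (H1 : dvd (modulus j) ((j + 1) * (modulus i * v))).
  { rewrite mul_comm. now apply dvd_mul. }
  assert (H2 : dvd (modulus j) ((i + 1) * (modulus j * v))).
  { apply (dvd_intro _ _ ((i + 1) * v)); [easy | ring]. }
  destruct (lt_total i j) as [L|[L|L]]; [|contradiction|].
  - apply lt_sub' in L as (e & He & <-).
    apply (dvd_modulus_aux (i + e) e); [easy|pose proof (le_add e i) as L; rewrite add_comm in L; ord|].
    apply (dvd_add_cancel _ _ _ Hp H2).
    replace ((i + 1) * (modulus (i + e) * v) + e * v)
      with ((i + e + 1) * (modulus i * v)) by (unfold modulus; ring).
    exact H1.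
  - apply lt_sub' in L as (e & He & <-).
    apply (dvd_modulus_aux j e); [easy|pose proof (le_add e j) as L; rewrite add_comm in L; ord|].
    apply (dvd_add_cancel _ _ _ Hp H1).
    replace ((j + 1) * (modulus (j + e) * v) + e * v)
      with ((j + e + 1) * (modulus j * v)) by (unfold modulus; ring).
    exact H2.
Qed.

Lemma moduli_multiple n : exists u, 0 < u /\ forall i, i < n -> dvd (modulus i) u.
Proof.
  revert n. apply Sig_induction.
  - unfold dvd, modulus; Sig_tac.
  - exists 1; split; [apply lt_0_1|]. intros e L; now apply not_lt_0 in L.
  - intros n (u & Hu & H). exists (u * modulus n); split.
    + apply mul_pos; [easy | apply modulus_pos].
    + intros i L. destruct (lt_succ_r _ _ L) as [L'| ->].
      * apply dvd_mul; [apply modulus_pos | now apply H].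
      * apply (dvd_intro _ _ u); [apply modulus_pos | ring].
Qed.

(** The least positive number divisible by the moduli of all elements codes the set
    exactly: a superfluous modulus could be divided out, as it is coprime to the others.
    Being divisible by these moduli is a Pi condition, hence the use of [least_Pi]. *)
Lemma Sig_coded th : rel0 th ->
  exists u, forall i, i < c -> ((exists x, th i x) <-> dvd (modulus i) u).
Proof.
  intros Hth.
  destruct (least_Pi (fun u => forall x, 0 < u /\ forall i, i < c -> th i x -> dvd (modulus i) u))
    as (u & Hu & Hleast).
  - unfold dvd, modulus; Pi_tac.
  - destruct (moduli_multiple c) as (u & Hu & H). exists u; auto.
  - exists u. intros i Hi; split; [intros [x Hx]; now apply (Hu x)|].
    intros (v & _ & Hv). apply NNPP; intros N.
    assert (Hv0 : 0 < v).
    { destruct (zero_le v) as [?| <-]; [easy|]. destruct (Hu 0) as [Hu0 _].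
      rewrite Hv, mul_0_r in Hu0. now apply lt_irrefl in Hu0. }
    apply (Hleast v).
    + rewrite Hv. pose proof (lt_mul_r _ _ v Hv0 (modulus_gt_1 i)) as L.
      now replace (1 * v) with v in L by ring.
    + intros x; split; [easy|]. intros j Hj Hx.
      apply (dvd_modulus_mul i j); [easy..| |].
      * intros ->. apply N. now exists x.
      * rewrite <- Hv. now apply (Hu x).
Qed.
End Coding.

(** Unlike in [Sig_collection], not every i needs a witness.  A code for the set of those
    that have one turns this into an instance of collection. *)
Lemma strong_bounding th : rel0 th -> forall c,
  exists b, forall i, i < c -> (exists x, th i x) -> exists x, x < b /\ th i x.
Proof.
  intros Hth c. destruct (common_multiple c) as (m & Hm & Hmult).
  destruct (Sig_coded c m Hm Hmult th Hth) as [u Hu].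
  destruct (Sig_collection (fun i x => dvd (modulus m i) u -> th i x)) with (c := c)
    as [b Hb].
  - unfold rel0, dvd, modulus; D0_tac.
  - intros i Hi. destruct (classic (dvd (modulus m i) u)) as [D|D].
    + apply (Hu i Hi) in D as [x Hx]. now exists x.
    + now exists 0.
  - exists b. intros i Hi Hx. destruct (Hb i Hi) as (x & L & H).
    exists x; split; [easy|]. now apply H, (Hu i Hi).
Qed.

(** * The pairing function *)

Local Notation "⟨ a , b ⟩" := (pair a b) : M_scope.

Lemma add_le a b c d : a <= b -> c <= d -> a + c <= b + d.
Proof.
  intros [L| ->] [L'| ->].
  - left. apply lt_trans with (b + c); [now apply lt_add_r|].
    rewrite !(add_comm b). now apply lt_add_r.
  - left. now apply lt_add_r.
  - left. rewrite !(add_comm b). now apply lt_add_r.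
  - now right.
Qed.

Lemma mul_le a b c d : a <= b -> c <= d -> a * c <= b * d.
Proof.
  intros L L'. apply le_sub in L as [u <-]. apply le_sub in L' as [v <-].
  replace ((a + u) * (c + v)) with (a * c + (a * v + u * c + u * v)) by ring. apply le_add.
Qed.

Lemma pair_lt a b c d : a < c -> b < d -> ⟨a, b⟩ < ⟨c, d⟩.
Proof.
  intros L L'. unfold pair.
  assert (L2 : a + b <= c + d) by (apply add_le; now left).
  pose proof (mul_le _ _ _ _ L2 L2) as [L3|E].
  - apply lt_trans with ((c + d) * (c + d) + a); [now apply lt_add_r|].
    rewrite !(add_comm ((c + d) * (c + d))). now apply lt_add_r.
  - rewrite E, !(add_comm ((c + d) * (c + d))). now apply lt_add_r.
Qed.

(** Adding a to the square of a + b does not reach the next square. *)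
Lemma pair_sum_lt a b c d : a + b < c + d -> ⟨a, b⟩ < ⟨c, d⟩.
Proof.
  intros L. apply lt_sub' in L as (e & He & E). destruct (pos_succ _ He) as [e' <-].
  unfold pair. rewrite <- E.
  replace ((a + b + (e' + 1)) * (a + b + (e' + 1)) + c)
    with (((a + b) * (a + b) + a + (a + b + b + ((a + b) * (e' + e') + e' * e' + e' + e' + c))) + 1)
    by ring.
  pose proof (le_add ((a + b) * (a + b) + a) (a + b + b + ((a + b) * (e' + e') + e' * e' + e' + e' + c))) as L.
  revert L. generalize ((a + b) * (a + b) + a + (a + b + b + ((a + b) * (e' + e') + e' * e' + e' + e' + c))).
  ord.
Qed.

Lemma pair_inj a b c d : ⟨a, b⟩ = ⟨c, d⟩ -> a = c /\ b = d.
Proof.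
  intros E. destruct (lt_total (a + b) (c + d)) as [L|[S|L]];
    [|clear -E S HM some_set|]; try (apply pair_sum_lt in L; rewrite E in L; now apply lt_irrefl in L).
  unfold pair in E. rewrite S, !(add_comm ((c + d) * (c + d))) in E.
  apply add_cancel_r in E as ->. split; [easy|].
  rewrite !(add_comm c) in S. now apply add_cancel_r in S.
Qed.

(** * The notions of the theorem, read in a model *)

Definition Relation_on A R := forall z, z ∈ R -> exists a b, a ∈ A /\ b ∈ A /\ z = ⟨a, b⟩.
Definition Functional F :=
  (forall n, exists a, ⟨n, a⟩ ∈ F) /\ (forall n a b, ⟨n, a⟩ ∈ F /\ ⟨n, b⟩ ∈ F -> a = b).
Definition Maps_N_to F A :=
  (forall z, z ∈ F -> exists n a, a ∈ A /\ z = ⟨n, a⟩) /\ Functional F.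
Definition Maps_N_to_N F := (forall z, z ∈ F -> exists n a, z = ⟨n, a⟩) /\ Functional F.
Definition Injection F :=
  Maps_N_to_N F /\ forall m n a, ⟨m, a⟩ ∈ F /\ ⟨n, a⟩ ∈ F -> m = n.
Definition Finite_set A := exists b, forall a, a ∈ A -> a < b.
Definition Quasi_order A R :=
  Relation_on A R /\ (forall a, a ∈ A -> ⟨a, a⟩ ∈ R)
  /\ (forall a b c, ⟨a, b⟩ ∈ R /\ ⟨b, c⟩ ∈ R -> ⟨a, c⟩ ∈ R).
Definition Partial_order A R :=
  Quasi_order A R /\ forall a b, ⟨a, b⟩ ∈ R /\ ⟨b, a⟩ ∈ R -> a = b.
Definition Wqo A R :=
  Quasi_order A R
  /\ forall G, Maps_N_to G A ->
       exists m n a b, m < n /\ ⟨m, a⟩ ∈ G /\ ⟨n, b⟩ ∈ G /\ ⟨a, b⟩ ∈ R.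
Definition Strictly_below R a b := ⟨a, b⟩ ∈ R /\ ~ ⟨b, a⟩ ∈ R.
Definition Incomparable R a b := ~ ⟨a, b⟩ ∈ R /\ ~ ⟨b, a⟩ ∈ R.
Definition True_at F n s :=
  n < s /\ forall k, n < k /\ k <= s -> exists a b, ⟨n, a⟩ ∈ F /\ ⟨k, b⟩ ∈ F /\ a < b.
Definition Candidate F n s := True_at F n s \/ n = s.
Definition Dropped F n s := Candidate F n s /\ ~ True_at F n (s + 1).
Definition Stage_drops F s :=
  (forall n, True_at F n (s + 1) -> Candidate F n s) /\ (exists n, Dropped F n s).
Definition Stage_keeps F s := forall n, True_at F n (s + 1) <-> Candidate F n s.
Definition Least_dropped F n s := Dropped F n s /\ forall k, Dropped F k s -> n <= k.
Definition Placed_above R z w y :=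
  (⟨y, w⟩ ∈ R -> Strictly_below R y z)
  /\ (Strictly_below R w y -> Strictly_below R z y)
  /\ (Incomparable R y w -> Incomparable R z y).
Definition Placed_below R z w y :=
  (Strictly_below R y w -> Strictly_below R y z)
  /\ (⟨w, y⟩ ∈ R -> Strictly_below R z y)
  /\ (Incomparable R y w -> Incomparable R z y).
Definition Is_Xi F P leP x Q leQ :=
  (forall z, z ∈ Q <-> exists n p, p ∈ P /\ z = ⟨n, p⟩)
  /\ Relation_on Q leQ
  /\ (forall n p q, p ∈ P /\ q ∈ P -> (⟨⟨n, p⟩, ⟨n, q⟩⟩ ∈ leQ <-> ⟨p, q⟩ ∈ leP))
  /\ (forall s, Stage_drops F s ->
       forall n0, Least_dropped F n0 s ->
       forall p n q, p ∈ P /\ n <= s /\ q ∈ P ->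
         Placed_above leQ ⟨s + 1, p⟩ ⟨n0, x⟩ ⟨n, q⟩)
  /\ (forall s, Stage_keeps F s ->
       forall p n q, p ∈ P /\ n <= s /\ q ∈ P ->
         Placed_below leQ ⟨s + 1, p⟩ ⟨s, x⟩ ⟨n, q⟩).

(** * Functions *)

(** Choice outside the model makes the graph a function; definability is always
    about the graph. *)
Definition apply (F : set M) (n : num M) : num M := epsilon (inhabits 0) (fun a => ⟨n, a⟩ ∈ F).

Lemma apply_iff F : Functional F -> forall n a, ⟨n, a⟩ ∈ F <-> a = apply F n.
Proof.
  intros [Hex Huniq] n a.
  assert (H : ⟨n, apply F n⟩ ∈ F) by exact (epsilon_spec (inhabits 0) _ (Hex n)).
  split; [intros Ha; now apply (Huniq n) | now intros ->].
Qed.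

(** By strong bounding there is a stage before which all values below [c] have been
    taken, and a value is not taken twice. *)
Lemma one_to_one_unbounded F : Functional F ->
  (forall m n a, ⟨m, a⟩ ∈ F -> ⟨n, a⟩ ∈ F -> m = n) ->
  forall c, exists b, forall n, ~ n < b -> ~ apply F n < c.
Proof.
  intros HF Hinj c.
  destruct (strong_bounding (fun i n => ⟨n, i⟩ ∈ F)) with (c := c) as [b Hb].
  - unfold rel0; D0_tac.
  - exists b. intros n Hn L.
    assert (Hn' : ⟨n, apply F n⟩ ∈ F) by now apply apply_iff.
    destruct (Hb _ L) as (m & Lm & Hm); [now exists n|].
    apply Hn. now rewrite (Hinj n m _ Hn' Hm).
Qed.

(** * True stages *)

Section TrueStages.
Variable F : set M.
Hypothesis F_injection : Injection F.

Let f := apply F.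

Lemma f_iff n a : ⟨n, a⟩ ∈ F <-> a = f n.
Proof. apply apply_iff, F_injection. Qed.

Lemma f_inj m n : f m = f n -> m = n.
Proof.
  intros E. apply (proj2 F_injection m n (f m)).
  rewrite !f_iff; auto.
Qed.

Lemma True_at_iff n s :
  True_at F n s <-> n < s /\ forall k, n < k -> k <= s -> f n < f k.
Proof.
  split; intros [L H]; split; try easy; intros k.
  - intros Lk Ls. destruct (H k (conj Lk Ls)) as (a & b & Ha & Hb & Lab).
    apply f_iff in Ha as ->; apply f_iff in Hb as ->; easy.
  - intros [Lk Ls]. exists (f n), (f k). rewrite !f_iff; auto.
Qed.

(** [True_at] quantifies over values of f.  Given the value [a] at [n], being true at a
    stage only says that smaller values are not taken at certain arguments, which is
    [D0]. *)
Definition true_with (n a s : num M) : Prop :=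
  n < s /\ forall k, k < s + 1 -> n < k -> forall b, b < a + 1 -> ~ ⟨k, b⟩ ∈ F.

Lemma true_with_iff n s : true_with n (f n) s <-> True_at F n s.
Proof.
  rewrite True_at_iff. split; intros [L H]; split; try easy.
  - intros k Lk Ls.
    assert (N : ~ f k < f n + 1).
    { intros L'. apply (H k) with (b := f k); [ord | easy.. | now apply f_iff]. }
    ord.
  - intros k Ls Lk b Lb Hb. apply f_iff in Hb as ->.
    assert (Ls' : k <= s) by ord. specialize (H k Lk Ls'). ord.
Qed.

Lemma True_at_lt n s : True_at F n s -> n < s.
Proof. now intros []. Qed.

Lemma True_at_antitone n s s' : True_at F n s' -> n < s -> s <= s' -> True_at F n s.
Proof.
  rewrite !True_at_iff. intros [_ H] L L'; split; [easy|].
  intros k Lk Lk'. apply H; [easy | ord].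
Qed.

Lemma True_at_trans t n s : True_at F t n -> True_at F n s -> True_at F t s.
Proof.
  rewrite !True_at_iff. intros [Ln H] [Ls H']; split; [ord|].
  intros k Lk Lk'. destruct (classic (n < k)) as [L|L].
  - apply lt_trans with (f n); [apply H; [easy | now right] | now apply H'].
  - apply H; [easy | ord].
Qed.

Lemma True_at_succ n s : True_at F n (s + 1) <-> Candidate F n s /\ f n < f (s + 1).
Proof.
  split.
  - intros H. pose proof (True_at_lt _ _ H) as L. split.
    + destruct (lt_succ_r _ _ L) as [L'|L']; [left | now right].
      apply (True_at_antitone _ _ _ H); [easy | ord].
    + apply True_at_iff in H as [_ H]. apply H; [easy | now right].
  - intros [[H| ->] L]; apply True_at_iff.
    + pose proof (True_at_lt _ _ H) as Ls. split; [ord|].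
      intros k Lk Lk'. destruct Lk' as [Lk'| ->]; [|easy].
      apply True_at_iff in H as [_ H]. apply H; [easy | ord].
    + split; [ord|]. intros k Lk Lk'. replace k with (s + 1) by ord. easy.
Qed.

Lemma Dropped_iff n s : Dropped F n s <-> Candidate F n s /\ ~ f n < f (s + 1).
Proof. unfold Dropped. rewrite True_at_succ. tauto. Qed.

Lemma Candidate_le n s : Candidate F n s -> n <= s.
Proof. intros [H| ->]; [left; now apply True_at_lt | now right]. Qed.

Lemma Candidate_between t n s : Candidate F t s -> t < n -> n <= s -> True_at F t n.
Proof.
  intros [H| ->] L L'; [now apply (True_at_antitone _ _ s) | exfalso; ord].
Qed.

(** The two cases of the construction are exhaustive; being dropped is a Sigma condition, so
    there is a least dropped stage. *)
Lemma keeps_or_least_dropped s :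
  Stage_keeps F s \/ Stage_drops F s /\ exists n, Least_dropped F n s.
Proof.
  destruct (classic (exists n, Dropped F n s)) as [H|H].
  - right; split; [split; [|easy]; intros n Hn; now apply True_at_succ in Hn|].
    destruct (least_Sig (fun n => Dropped F n s)) as (n & Hn & Hleast).
    + apply Sig_ext with (fun rho => exists a, ⟨rho O, a⟩ ∈ F
        /\ (true_with (rho O) a s \/ rho O = s) /\ ~ true_with (rho O) a (s + 1)).
      * intros rho. unfold Dropped, Candidate. rewrite <- !true_with_iff. split.
        -- intros (a & Ha & H1 & H2). apply f_iff in Ha as ->. auto.
        -- intros [H1 H2]. exists (f (rho O)). rewrite f_iff; auto.
      * unfold true_with. Sig_tac.
    + exact H.
    + exists n; split; [easy|]. intros k Hk. specialize (Hleast k).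
      destruct (classic (k < n)) as [L|L]; [now apply Hleast in L | ord].
  - left; intros n. rewrite True_at_succ. split; [now intros []|].
    intros HC; split; [easy|]. apply NNPP; intros N. apply H. exists n.
    now apply Dropped_iff.
Qed.

(** The least value taken from [N] on is taken at a stage that stays true. *)
Lemma exists_true N : exists t, ~ t < N /\ forall s, t < s -> True_at F t s.
Proof.
  destruct (least_Sig (fun a => exists n, ~ n < N /\ ⟨n, a⟩ ∈ F)) as (a & (t & Lt & Ht) & Hleast).
  - Sig_tac.
  - exists (f N), N. rewrite f_iff; split; [apply lt_irrefl | easy].
  - exists t; split; [easy|]. intros s Ls. apply True_at_iff; split; [easy|].
    intros k Lk _. apply f_iff in Ht as ->.
    destruct (lt_total (f t) (f k)) as [L|[E|L]]; [easy| |].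
    + apply f_inj in E as ->. exfalso; ord.
    + exfalso. apply (Hleast (f k) L). exists k; split; [ord | now apply f_iff].
Qed.

(** * The order of Xi *)

Section Xi.
Variables P leP Q leQ : set M.
Variable x : num M.
Hypothesis P_order : Partial_order P leP.
Hypothesis P_finite : Finite_set P.
Hypothesis x_in_P : x ∈ P.
Hypothesis Q_Xi : Is_Xi F P leP x Q leQ.

Local Notation below a b := (Strictly_below leQ a b).

(** Relative to an element other than w, being immediately above w is being in the place of
    w; relative to w itself it is being above.  Both are expressed at once. *)
Lemma Placed_above_iff z w y : Placed_above leQ z w y ->
  (⟨y, z⟩ ∈ leQ <-> ⟨y, w⟩ ∈ leQ) /\ (⟨z, y⟩ ∈ leQ <-> below w y).
Proof.
  unfold Placed_above, Strictly_below, Incomparable.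
  destruct (classic (⟨y, w⟩ ∈ leQ)), (classic (⟨w, y⟩ ∈ leQ)); tauto.
Qed.

Lemma Placed_below_iff z w y : Placed_below leQ z w y ->
  (⟨y, z⟩ ∈ leQ <-> below y w) /\ (⟨z, y⟩ ∈ leQ <-> ⟨w, y⟩ ∈ leQ).
Proof.
  unfold Placed_below, Strictly_below, Incomparable.
  destruct (classic (⟨y, w⟩ ∈ leQ)), (classic (⟨w, y⟩ ∈ leQ)); tauto.
Qed.

Lemma leQ_copy n p q : p ∈ P -> q ∈ P -> (⟨⟨n, p⟩, ⟨n, q⟩⟩ ∈ leQ <-> ⟨p, q⟩ ∈ leP).
Proof. intros; now apply Q_Xi. Qed.

Definition earlier (s y : num M) : Prop := exists n q, n <= s /\ q ∈ P /\ y = ⟨n, q⟩.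

Lemma placement s :
  (exists k, Least_dropped F k s /\
     forall p y, p ∈ P -> earlier s y -> Placed_above leQ ⟨s + 1, p⟩ ⟨k, x⟩ y)
  \/ (Stage_keeps F s /\
     forall p y, p ∈ P -> earlier s y -> Placed_below leQ ⟨s + 1, p⟩ ⟨s, x⟩ y).
Proof.
  destruct Q_Xi as (_ & _ & _ & Hdrop & Hkeep).
  destruct (keeps_or_least_dropped s) as [H|[H [k Hk]]]; [right | left; exists k];
    (split; [easy|]); intros p y Hp (n & q & Hn & Hq & ->); auto.
Qed.

(** By strong induction on m = s + 1.  The new copy is next to x_k for some candidate k at
    stage s, so its position relative to x_t is that of x_k, which the induction
    hypothesis gives at stage max(t, k); t = k is decided by the side on which the copy is
    placed.  If stages are dropped, k is the least of them, and the candidates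
    surviving are those before k. *)
Lemma later_copies : forall m t p, t < m -> p ∈ P ->
  (True_at F t m -> below ⟨m, p⟩ ⟨t, x⟩) /\ (~ True_at F t m -> below ⟨t, x⟩ ⟨m, p⟩).
Proof.
  assert (H : forall m t p a, t < m -> p ∈ P -> ⟨t, a⟩ ∈ F ->
    (true_with t a m -> below ⟨m, p⟩ ⟨t, x⟩) /\ (~ true_with t a m -> below ⟨t, x⟩ ⟨m, p⟩)).
  { apply (strong_Pi_induction (fun m => forall t p a, t < m -> p ∈ P -> ⟨t, a⟩ ∈ F ->
      (true_with t a m -> below ⟨m, p⟩ ⟨t, x⟩) /\ (~ true_with t a m -> below ⟨t, x⟩ ⟨m, p⟩)));
      [unfold true_with, Strictly_below; Pi_tac|].
    intros m IH0 t p a L Hp Ha. apply f_iff in Ha as ->. rewrite true_with_iff.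
    assert (IH : forall n t, n < m -> t < n ->
      (True_at F t n -> below ⟨n, x⟩ ⟨t, x⟩) /\ (~ True_at F t n -> below ⟨t, x⟩ ⟨n, x⟩)).
    { intros n u Ln Lu. rewrite <- true_with_iff. apply IH0; auto. now apply f_iff. }
    clear IH0. destruct (pos_succ m) as [s <-].
    { destruct (zero_le t); ord. }
    assert (Ls : t <= s) by ord.
    assert (Ht : earlier s ⟨t, x⟩) by (exists t, x; auto).
    destruct (placement s) as [(k & [Hk Hleast] & Hpl)|[Hk Hpl]]; specialize (Hpl p _ Hp Ht).
    - apply Placed_above_iff in Hpl as [E1 E2].
      pose proof (proj1 (Dropped_iff _ _) Hk) as [Ck Vk]. pose proof (Candidate_le _ _ Ck) as Lk.
      unfold Strictly_below at 1 2. rewrite E1, E2. split.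
      + intros HT. apply True_at_succ in HT as [Ct Vt].
        (* The dropped stages form a final segment of the candidates. *)
        assert (Ltk : t < k).
        { destruct (lt_total t k) as [?|[->|Lkt]]; [easy | contradiction |]. exfalso.
          apply (Candidate_between k t s) in Ck; [|easy..].
          apply True_at_iff in Ck as [_ Ck]. specialize (Ck t Lkt (or_intror eq_refl)). ord. }
        assert (B : below ⟨k, x⟩ ⟨t, x⟩).
        { apply (proj1 (IH k t ltac:(ord) Ltk)). now apply (Candidate_between t k s). }
        split; [exact B | apply B].
      + intros HT.
        assert (B : t = k \/ below ⟨t, x⟩ ⟨k, x⟩).
        { destruct (lt_total t k) as [L'|[?|L']]; [|now left|]; right.
          - apply (proj2 (IH k t ltac:(ord) L')). intros HT'.
            assert (Ct : Candidate F t s).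
            { destruct Ck as [Ck| ->]; left; [now apply True_at_trans with k | easy]. }
            assert (D : Dropped F t s) by now split.
            apply Hleast in D. ord.
          - apply (proj1 (IH t k L L')). now apply (Candidate_between k t s). }
        destruct B as [-> |[B B']].
        * assert (R : ⟨⟨k, x⟩, ⟨k, x⟩⟩ ∈ leQ) by (apply leQ_copy; [easy..|]; now apply P_order).
          unfold Strictly_below; tauto.
        * unfold Strictly_below; tauto.
    - apply Placed_below_iff in Hpl as [E1 E2].
      unfold Strictly_below at 1 2. rewrite E1, E2, (Hk t). split.
      + intros Ct.
        assert (B : t = s \/ below ⟨s, x⟩ ⟨t, x⟩).
        { destruct Ct as [Ct|Ct]; [right | now left].
          apply (proj1 (IH s t ltac:(ord) (True_at_lt _ _ Ct))). easy. }
        destruct B as [-> |[B B']].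
        * assert (R : ⟨⟨s, x⟩, ⟨s, x⟩⟩ ∈ leQ) by (apply leQ_copy; [easy..|]; now apply P_order).
          unfold Strictly_below; tauto.
        * unfold Strictly_below; tauto.
      + intros Ct.
        assert (B : below ⟨t, x⟩ ⟨s, x⟩).
        { destruct Ls as [Ls|Ls]; [|exfalso; apply Ct; now right].
          apply (proj2 (IH s t ltac:(ord) Ls)). intros HT; apply Ct; now left. }
        split; [exact B | apply B]. }
  intros m t p L Hp. rewrite <- true_with_iff. apply H; auto. now apply f_iff.
Qed.

Lemma leQ_Relation_on : Relation_on Q leQ.
Proof. apply Q_Xi. Qed.

Lemma in_Q z : z ∈ Q <-> exists n p, p ∈ P /\ z = ⟨n, p⟩.
Proof. apply Q_Xi. Qed.

Definition transitive_before (s : num M) : Prop :=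
  forall n1 n2 n3 p1 p2 p3,
    n1 < s -> n2 < s -> n3 < s -> p1 ∈ P -> p2 ∈ P -> p3 ∈ P ->
    ⟨⟨n1, p1⟩, ⟨n2, p2⟩⟩ ∈ leQ -> ⟨⟨n2, p2⟩, ⟨n3, p3⟩⟩ ∈ leQ -> ⟨⟨n1, p1⟩, ⟨n3, p3⟩⟩ ∈ leQ.

(** A new copy compares with all earlier elements as the element w does that it is placed
    next to, up to strictness.  So a triple meeting the new copy reduces to one with w in
    its place. *)
Lemma leQ_transitive_before s : transitive_before s.
Proof.
  revert s. apply Pi_induction.
  { unfold transitive_before; Pi_tac. }
  { intros n1 n2 n3 p1 p2 p3 L; now apply not_lt_0 in L. }
  intros s IH n1 n2 n3 p1 p2 p3 L1 L2 L3 Hp1 Hp2 Hp3.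
  destruct (zero_le s) as [Hs| <-].
  2: { replace n1 with 0 by (destruct (zero_le n1); ord).
       replace n2 with 0 by (destruct (zero_le n2); ord).
       replace n3 with 0 by (destruct (zero_le n3); ord).
       rewrite !leQ_copy by easy. destruct P_order as [[_ [_ HT]] _]. intros; now apply (HT p1 p2). }
  destruct (pos_succ s Hs) as [r Er].
  assert (IH' : forall a b c, earlier r a -> earlier r b -> earlier r c ->
    ⟨a, b⟩ ∈ leQ -> ⟨b, c⟩ ∈ leQ -> ⟨a, c⟩ ∈ leQ).
  { intros a b c (m1 & q1 & K1 & M1 & ->) (m2 & q2 & K2 & M2 & ->) (m3 & q3 & K3 & M3 & ->).
    rewrite <- Er in IH. apply IH; try easy; ord. }
  assert (Hcase : forall n p, n < s + 1 -> p ∈ P -> earlier r ⟨n, p⟩ \/ n = s).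
  { intros n p L Hp. apply lt_succ_r in L as [L|L]; [left | now right].
    exists n, p. split; [ord | auto]. }
  assert (HPT : forall p q r, ⟨p, q⟩ ∈ leP -> ⟨q, r⟩ ∈ leP -> ⟨p, r⟩ ∈ leP).
  { destruct P_order as [[_ [_ HT]] _]. intros a b c; intros; now apply (HT a b c). }
  (* The two alternatives are placement above and below w.  In each, every combination of
     old and new positions reduces to transitivity among old elements or inside P. *)
  assert (Hstep : forall w, earlier r w ->
    (forall p y, p ∈ P -> earlier r y ->
       (⟨y, ⟨s, p⟩⟩ ∈ leQ <-> ⟨y, w⟩ ∈ leQ) /\ (⟨⟨s, p⟩, y⟩ ∈ leQ <-> below w y))
    \/ (forall p y, p ∈ P -> earlier r y ->
       (⟨y, ⟨s, p⟩⟩ ∈ leQ <-> below y w) /\ (⟨⟨s, p⟩, y⟩ ∈ leQ <-> ⟨w, y⟩ ∈ leQ)) ->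
    ⟨⟨n1, p1⟩, ⟨n2, p2⟩⟩ ∈ leQ -> ⟨⟨n2, p2⟩, ⟨n3, p3⟩⟩ ∈ leQ -> ⟨⟨n1, p1⟩, ⟨n3, p3⟩⟩ ∈ leQ).
  { intros w Hw [E|E];
    destruct (Hcase n1 p1 L1 Hp1) as [O1|O1]; try rewrite O1 in *;
    destruct (Hcase n2 p2 L2 Hp2) as [O2|O2]; try rewrite O2 in *;
    destruct (Hcase n3 p3 L3 Hp3) as [O3|O3]; try rewrite O3 in *;
    rewrite ?leQ_copy by easy;
    rewrite ?(proj1 (E _ _ Hp1 O2)), ?(proj1 (E _ _ Hp1 O3)), ?(proj1 (E _ _ Hp2 O1)),
      ?(proj1 (E _ _ Hp2 O3)), ?(proj1 (E _ _ Hp3 O1)), ?(proj1 (E _ _ Hp3 O2)),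
      ?(proj2 (E _ _ Hp1 O2)), ?(proj2 (E _ _ Hp1 O3)), ?(proj2 (E _ _ Hp2 O1)),
      ?(proj2 (E _ _ Hp2 O3)), ?(proj2 (E _ _ Hp3 O1)), ?(proj2 (E _ _ Hp3 O2));
    unfold Strictly_below; intuition eauto. }
  destruct (placement r) as [(k & [[Hk _] _] & Hpl)|[_ Hpl]]; rewrite Er in Hpl.
  - apply (Hstep ⟨k, x⟩).
    + exists k, x. split; [now apply Candidate_le | auto].
    + left. intros p y Hp Hy. now apply Placed_above_iff, Hpl.
  - apply (Hstep ⟨r, x⟩).
    + exists r, x. auto.
    + right. intros p y Hp Hy. now apply Placed_below_iff, Hpl.
Qed.

Lemma leQ_trans a b c : ⟨a, b⟩ ∈ leQ -> ⟨b, c⟩ ∈ leQ -> ⟨a, c⟩ ∈ leQ.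
Proof.
  intros Hab Hbc.
  destruct (leQ_Relation_on _ Hab) as (a' & b' & Ha & Hb & E). apply pair_inj in E as [<- <-].
  destruct (leQ_Relation_on _ Hbc) as (b' & c' & _ & Hc & E). apply pair_inj in E as [<- <-].
  apply in_Q in Ha as (n1 & p1 & Hp1 & ->). apply in_Q in Hb as (n2 & p2 & Hp2 & ->).
  apply in_Q in Hc as (n3 & p3 & Hp3 & ->).
  pose proof (le_add (n1 + 1) (n2 + 1 + (n3 + 1))) as L1.
  pose proof (le_add (n2 + 1) (n1 + 1 + (n3 + 1))) as L2.
  pose proof (le_add (n3 + 1) (n1 + 1 + (n2 + 1))) as L3.
  set (s := n1 + 1 + (n2 + 1 + (n3 + 1))) in *.
  replace (n2 + 1 + (n1 + 1 + (n3 + 1))) with s in L2 by (unfold s; ring).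
  replace (n3 + 1 + (n1 + 1 + (n2 + 1))) with s in L3 by (unfold s; ring).
  clearbody s. apply (leQ_transitive_before s n1 n2 n3 p1 p2 p3); try easy; ord.
Qed.

Lemma Q_quasi_order : Quasi_order Q leQ.
Proof.
  split; [exact leQ_Relation_on|]. split.
  - intros z Hz. apply in_Q in Hz as (n & p & Hp & ->). apply leQ_copy; [easy..|].
    now apply P_order.
  - intros a b c []; now apply (leQ_trans a b c).
Qed.

(** * Bad sequences *)

Section BadSequence.
Variable G : set M.
Hypothesis G_maps : Maps_N_to G Q.
Hypothesis G_bad : forall m n a b, m < n -> ⟨m, a⟩ ∈ G -> ⟨n, b⟩ ∈ G -> ~ ⟨a, b⟩ ∈ leQ.

Lemma G_one_to_one m n a : ⟨m, a⟩ ∈ G -> ⟨n, a⟩ ∈ G -> m = n.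
Proof.
  intros Hm Hn.
  assert (R : ⟨a, a⟩ ∈ leQ).
  { apply Q_quasi_order. destruct (proj1 G_maps _ Hm) as (m' & a' & Ha & E).
    apply pair_inj in E as [_ ->]; easy. }
  destruct (lt_total m n) as [L|[L|L]]; [|easy|]; exfalso.
  - exact (G_bad m n a a L Hm Hn R).
  - exact (G_bad n m a a L Hn Hm R).
Qed.

(** The first c copies of P are bounded by a number, as P is, and the sequence leaves every
    bounded set. *)
Lemma G_reaches_late_copies i c : exists j n p, i < j /\ p ∈ P /\ ⟨j, ⟨n, p⟩⟩ ∈ G /\ ~ n < c.
Proof.
  destruct P_finite as [b Hb].
  destruct (one_to_one_unbounded G (proj2 G_maps) G_one_to_one ⟨c, b⟩) as [k Hk].
  assert (J : exists j, i < j /\ ~ j < k).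
  { destruct (classic (i < k)); [exists k | exists (i + 1)]; split; ord. }
  destruct J as (j & Li & Lk).
  assert (Hj : ⟨j, apply G j⟩ ∈ G) by (apply apply_iff; [apply G_maps | easy]).
  destruct (proj1 G_maps _ Hj) as (j' & z & Hz & E). apply pair_inj in E as [_ <-].
  apply in_Q in Hz as (n & p & Hp & E). specialize (Hk j Lk). rewrite E in Hj, Hk.
  exists j, n, p. do 3 (split; [easy|]).
  intros L. apply Hk, pair_lt; auto.
Qed.

(** If t were dropped by stage s, then G(i) would be below x_t, and a term of G in a copy
    from s on above it. *)
Lemma bad_true t i n p : p ∈ P -> ⟨i, ⟨n, p⟩⟩ ∈ G -> True_at F t n ->
  forall s, t < s -> True_at F t s.
Proof.
  intros Hp Hi Ht s Ls. apply NNPP; intros N.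
  destruct (G_reaches_late_copies i s) as (j & m & q & Lij & Hq & Hj & Lm).
  apply (G_bad _ _ _ _ Lij Hi Hj). apply leQ_trans with ⟨t, x⟩.
  - now apply (later_copies n t p (True_at_lt _ _ Ht) Hp).
  - assert (Ltm : t < m) by ord. apply (later_copies m t q Ltm Hq).
    intros HT. apply N, (True_at_antitone _ _ m); [easy..|ord].
Qed.

(** Sufficiently late permanently true stages have large values, and occur as true stages
    for the terms of G in later copies. *)
Lemma bad_reaches v : exists i n p t, p ∈ P /\ ⟨i, ⟨n, p⟩⟩ ∈ G /\ True_at F t n /\ v < f t.
Proof.
  destruct (one_to_one_unbounded F) with (c := v + 1) as [b Hb].
  { apply F_injection. }
  { intros m n a Hm Hn. now apply (proj2 F_injection m n a). }
  destruct (exists_true b) as (t & Lt & Ht). specialize (Hb t Lt). fold f in Hb.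
  destruct (G_reaches_late_copies 0 (t + 1)) as (i & n & p & _ & Hp & Hi & Ln).
  exists i, n, p, t. do 2 (split; [easy|]). split; [apply Ht; ord | ord].
Qed.

(** A permanently true t bounds the search for an argument of v < f(t). *)
Lemma not_in_range_iff v : ~ (exists m, ⟨m, v⟩ ∈ F) <->
  exists i n p t a, p ∈ P /\ ⟨i, ⟨n, p⟩⟩ ∈ G /\ ⟨t, a⟩ ∈ F /\ true_with t a n /\ v < a
    /\ forall k, k < t + 1 -> ~ ⟨k, v⟩ ∈ F.
Proof.
  split.
  - intros N. destruct (bad_reaches v) as (i & n & p & t & Hp & Hi & Ht & Lv).
    exists i, n, p, t, (f t). rewrite f_iff, true_with_iff. do 5 (split; [easy|]).
    intros k _ Hk. apply N. now exists k.
  - intros (i & n & p & t & a & Hp & Hi & Ha & Ht & Lv & Hk) [m Hm].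
    apply f_iff in Ha as ->. apply true_with_iff in Ht.
    destruct (classic (m < t + 1)) as [L|L]; [exact (Hk m L Hm)|].
    assert (Ltm : t < m) by ord.
    pose proof (bad_true t i n p Hp Hi Ht m Ltm) as Htm. apply True_at_iff in Htm as [_ Htm].
    specialize (Htm m Ltm (or_intror eq_refl)). apply f_iff in Hm as ->. ord.
Qed.

Lemma range_exists : exists X, forall n, n ∈ X <-> exists m, ⟨m, n⟩ ∈ F.
Proof.
  apply D1_comprehension; [Sig_tac|].
  apply Sig_ext with (1 := fun rho => iff_sym (not_in_range_iff (rho O))).
  unfold true_with. Sig_tac.
Qed.

End BadSequence.

Lemma not_wqo_range : ~ Wqo Q leQ -> exists X, forall n, n ∈ X <-> exists m, ⟨m, n⟩ ∈ F.
Proof.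
  intros N. apply NNPP; intros N'. apply N. split; [exact Q_quasi_order|].
  intros G HG. apply NNPP; intros HB. apply N', (range_exists G HG).
  intros m n a b L Hm Hn R. apply HB. now exists m, n, a, b.
Qed.

End Xi.
End TrueStages.
End Model.

Local Open Scope fm_scope.

Theorem lemma4p4 :
  RCA0_proves
    (∀₂ F P leP, ∀ x, ∀₂ Q leQ,
       injection F
       ∧ partial_order P leP ∧ finite_set P ∧ x ∈ P
       ∧ is_Xi F P leP x Q leQ
       ∧ ¬ wqo Q leQ
       → ∃₂ X, ∀ n, n ∈ X ↔ ∃ m, ⟨m, n⟩ ∈ F).
Proof.
  apply completeness; [exact RCA0_subst_closed|]. intros M rho eta HM.
  refine (proj2 (_ : _ <-> forall F P leP x Q leQ,
    Injection M F /\ Partial_order M P leP /\ Finite_set M P /\ mem M x P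
    /\ Is_Xi M F P leP x Q leQ /\ ~ Wqo M Q leQ ->
    exists X, forall n, mem M n X <-> exists m, mem M (pair M m n) F) _).
  - lazymatch goal with
    | |- sat _ _ _ ?A <-> _ =>
        let A' := eval cbv -[And Or Iff ExN ExS Neg] in A in change A with A'
    end.
    sat_congr.
  - intros F P leP x Q leQ (HF & HP & Hfin & Hx & HX & HW).
    exact (not_wqo_range M HM F F HF P leP Q leQ x HP Hfin Hx HX HW).
Qed.
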